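(* Suppose $\mu=2$, $d=2k$ with $k\ge3$, and the parametrization $\phi$ is proper with a very singular point (placed at $(0:0:1)$ by a linear change of coordinates). Then a minimal set of generators of $\mathcal K$ is the following set of $k+3=\frac{d+6}{2}$ polynomials: $$\{\mathcal E_d(\underline X),\,F^0_{1,k}(\underline T,\underline X),\,F^1_{1,k}(\underline T,\underline X),\,F_{2,1}(\underline T,\underline X),\,F_{2,k-1}(\underline T,\underline X),\ldots,F_{2(k-1),1}(\underline T,\underline X)\},$$ where the dots run over $F_{2(k-j),j}(\underline T,\underline X)$, $j=k-1,\ldots,1$, and all polynomials are as constructed in the context.
   Context: Let $\mathbb K$ be an algebraically closed field, $\underline T=(T_0,T_1)$, $\underline X=(X_0,X_1,X_2)$, and let $u_0,u_1,u_2\in\mathbb K[\underline T]$ be homogeneous of the same degree $d\ge1$ without common factors; $\underline u=(u_0,u_1,u_2)$, $I=\langle u_0,u_1,u_2\rangle\subset\mathbb K[\underline T]$. $\mathrm{Rees}(I)=\bigoplus_{n\ge0}I^nZ^n$ and $\mathcal K$ is the kernel of the $\mathbb K[\underline T]$-algebra epimorphism $\mathbb K[\underline T][\underline X]\to\mathrm{Rees}(I)$, $X_i\mapsto u_i(\underline T)Z$; it is a bihomogeneous ideal, and $\mathcal K_{i,j}$ is its component of bidegree $(i,j)$ ($i$ in $\underline T$, $j$ in $\underline X$). A double subscript $i,j$ on a polynomial in $\underline T,\underline X$ denotes its bidegree. $\mathcal K_{*,1}\cong\mathrm{Syz}(I)$ is a free $\mathbb K[\underline T]$-module of rank 2; fix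 a basis $P_{\mu,1},Q_{d-\mu,1}$ of bidegrees $(\mu,1),(d-\mu,1)$ with $0\le\mu\le d/2$ ($\mu$ is determined by $I$). The map $\phi:\mathbb P^1\to\mathbb P^2$, $(t_0:t_1)\mapsto(u_0:u_1:u_2)(t_0,t_1)$, is proper if it is birational onto its image, the curve $C$. $\mathcal E_d(\underline X)$ is the irreducible homogeneous polynomial of degree $d$ defining $C$. A point $\mathbf p\in C$ is very singular if $\mathrm{mult}_{\mathbf p}(C)>\mu$. Coordinates are chosen so that the very singular point is $(0:0:1)$; then, with $\mu=2$, $P_{2,1}=p^1_2(\underline T)X_0-p^0_2(\underline T)X_1$ with $p^0_2,p^1_2$ homogeneous of degree 2. Operator $\mathcal D_T$: if $G_{i,j}$ has bidegree $(i,j)$ with $i\ge3$, write $G_{i,j}=p^0_2(\underline T)G^0_{i-2,j}+p^1_2(\underline T)G^1_{i-2,j}$ (possible; choose any such decomposition) and set $\mathcal D_T(G_{i,j})=X_0G^0_{i-2,j}+X_1G^1_{i-2,j}$, of bidegree $(i-2,j+1)$. With $d=2k$: $F_{2,1}:=P_{2,1}$, $F_{2(k-1),1}:=Q_{d-2,1}$, and for $j=2,\ldots,k-1$, $F_{2(k-j),j}:=\mathcal D_T\big(F_{2(k-j+1),j-1}\big)$. Write $$F_{2,1}=T_0^2\mathcal F^0_1(\underline X)+T_1^2\mathcal F^1_1(\underline X)+T_0T_1\mathcal F^*_1(\underline X),\quad F_{2,k-1}=T_0^2\mathcal M^0_{k-1}(\underline X)+T_1^2\mathcal M^1_{k-1}(\underline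 X)+T_0T_1\mathcal M^*_{k-1}(\underline X).$$ $F^0_{1,k}$ and $F^1_{1,k}$ are defined by $$\mathcal M^0_{k-1}F_{2,1}-\mathcal F^0_1F_{2,k-1}=T_1F^0_{1,k},\qquad \mathcal M^1_{k-1}F_{2,1}-\mathcal F^1_1F_{2,k-1}=T_0F^1_{1,k}.$$ *)

(* Defs.v *)
From HB Require Import structures.
From mathcomp Require Import all_boot all_order all_algebra.
From mathcomp Require Import mpoly.

Set Implicit Arguments.
Unset Strict Implicit.
Unset Printing Implicit Defensive.

Import GRing.Theory.
Local Open Scope ring_scope.

Section MinimalGenerators.
Variable R : comNzRingType.

Definition in_ideal_gen (s : seq R) (f : R) : Prop :=
  exists c : nat -> R, f = \sum_(i < size s) c i * s`_i.

Definition generates (I : R -> Prop) (s : seq R) : Prop :=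
  forall f, I f <-> in_ideal_gen s f.

Definition minimal_generators (I : R -> Prop) (s : seq R) : Prop :=
  [/\ uniq s, generates I s
    & forall s' : seq R, {subset s' <= s} -> generates I s' -> {subset s <= s'}].

End MinimalGenerators.

Section Rees.
Variable K : closedFieldType.

(* K[T0,T1], K[X0,X1,X2] and K[T][X]. *)
Notation KT := {mpoly K[2]}.
Notation KX := {mpoly K[3]}.
Notation KTX := {mpoly {mpoly K[2]}[3]}.

Definition liftX (F : KX) : KTX := map_mpoly (@mpolyC 2 K) F.

Definition bihomog (i j : nat) (G : KTX) : Prop :=
  G \is j.-homog /\ forall m, G@_m \is i.-homog.

Definition mirreducible (n : nat) (F : {mpoly K[n]}) : Prop :=
  [/\ F != 0, F \isn't a GRing.unit
    & forall G H : {mpoly K[n]}, F = G * H -> G \is a GRing.unit \/ H \is a GRing.unit].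

Definition parametrization (d : nat) (u : 'I_3 -> KT) : Prop :=
  (forall i, u i \is d.-homog) /\
  (forall g : KT, (forall i, exists h, u i = h * g) -> g \is a GRing.unit).

(* The map X_i |-> u_i Z.  Its image is Rees(I), a subring of K[T][Z], so its
   kernel is that of the epimorphism onto Rees(I). *)
Definition rees_map (u : 'I_3 -> KT) : KTX -> {poly KT} :=
  mmap (@polyC KT) (fun i => u i *: 'X).

Definition rees_ker (u : 'I_3 -> KT) (G : KTX) : Prop := rees_map u G = 0.

Definition mu_basis (u : 'I_3 -> KT) (d mu : nat) (P Q : KTX) : Prop :=
  [/\ (2 * mu <= d)%N,
      rees_ker u P /\ bihomog mu 1 P,
      rees_ker u Q /\ bihomog (d - mu) 1 Q
    & forall G, rees_ker u G -> G \is 1.-homog ->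
        exists! ab : KT * KT, G = ab.1 *: P + ab.2 *: Q].

(* Projective points are given by nonzero coordinate vectors. *)
Definition nonzero n (x : 'I_n -> K) : Prop := exists i, x i != 0.

Definition proj_eq n (x y : 'I_n -> K) : Prop :=
  exists2 c : K, c != 0 & forall i, x i = c * y i.

Definition eval_map m n (f : 'I_n -> {mpoly K[m]}) (x : 'I_m -> K) : 'I_n -> K :=
  fun i => (f i).@[x].

(* The image C of phi (which is closed, P^1 being complete). *)
Definition on_curve (u : 'I_3 -> KT) (x : 'I_3 -> K) : Prop :=
  exists2 t : 'I_2 -> K, nonzero t & proj_eq x (eval_map u t).

(* phi is birational onto C: there is a rational map (A_0 : A_1) from C to P^1,
   defined at some point of the irreducible curve C, whose composites with phi
   are the identity wherever they are defined. *)
Definition proper_param (u : 'I_3 -> KT) : Prop :=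
  exists (e : nat) (A : 'I_2 -> KX),
  [/\ forall i, A i \is e.-homog,
      exists2 x, on_curve u x & nonzero (eval_map A x),
      forall t, nonzero t -> nonzero (eval_map A (eval_map u t)) ->
        proj_eq (eval_map A (eval_map u t)) t
    & forall x, on_curve u x -> nonzero (eval_map A x) ->
        proj_eq (eval_map u (eval_map A x)) x].

Definition curve_equation (u : 'I_3 -> KT) (d : nat) (E : KX) : Prop :=
  [/\ mirreducible E, E \is d.-homog
    & forall x, nonzero x -> (E.@[x] = 0 <-> on_curve u x)].

(* Lowest degree of a monomial of f, for f != 0 (and 0 for f = 0). *)
Definition morder n (f : {mpoly K[n]}) : nat :=
  \big[minn/msize f]_(m <- msupp f) mdeg m.

(* The equation of F = 0 in the affine chart X_i = p_i, p_i != 0, with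
   the origin translated to p; its order is the multiplicity of F at p. *)
Definition local_equation (F : KX) (i : 'I_3) (p : 'I_3 -> K) : KX :=
  F \mPo [tuple (if j == i then 0 else 'X_j) + (p j)%:MP | j < 3].

Definition very_singular (u : 'I_3 -> KT) (E : KX) (mu : nat) (p : 'I_3 -> K)
    : Prop :=
  on_curve u p /\
  exists2 i : 'I_3, p i != 0 & (mu < morder (local_equation E i p))%N.

Definition pt001 : 'I_3 -> K := fun i => (i == ord_max)%:R.

(* P = p^1 X_0 - p^0 X_1; the X_2-coefficient of P vanishes when (0:0:1) is
   very singular. *)
Definition coef_p0 (P : KTX) : KT := - P@_U_(1).
Definition coef_p1 (P : KTX) : KT := P@_U_(0).

(* H is a value of D_T(G), G of bidegree (i, j), for some choice of the
   decomposition of G. *)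
Definition DT (p0 p1 : KT) (i j : nat) (G H : KTX) : Prop :=
  exists G0 G1 : KTX,
  [/\ bihomog (i - 2) j G0, bihomog (i - 2) j G1,
      G = p0 *: G0 + p1 *: G1
    & H = 'X_0 * G0 + 'X_1 * G1].

(* F j stands for F_{2(k-j),j}, 1 <= j <= k-1. *)
Definition F_family (k : nat) (P Q : KTX) (F : nat -> KTX) : Prop :=
  F 1%N = Q /\
  forall j, (2 <= j <= k - 1)%N ->
    DT (coef_p0 P) (coef_p1 P) (2 * (k - j + 1)) (j - 1) (F (j - 1)%N) (F j).

Definition T_quadratic (G : KTX) (a0 a1 as_ : KX) : Prop :=
  G = ('X_0 ^+ 2 : KT) *: liftX a0 + ('X_1 ^+ 2 : KT) *: liftX a1
      + ('X_0 * 'X_1 : KT) *: liftX as_.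

Definition generators (k : nat) (E : KX) (F0 F1 P : KTX) (F : nat -> KTX)
    : seq KTX :=
  [:: liftX E; F0; F1; P] ++ [seq F j | j <- iota 1 (k - 1)].

End Rees.

(* Main.v *)
Require Import Defs.
From HB Require Import structures.
From mathcomp Require Import all_boot all_order all_algebra.
From mathcomp Require Import mpoly ring zify.
From Stdlib Require Import Classical.

(** Write K for the ideal of moving curves, the kernel of X_i |-> u_i Z.

    _The moving line P._  Because phi is birational, the projection of the curve
    from (0:0:1) has degree, as a map from the parameter line, at most the degree
    in X_2 of the equation ([projection_degree_le]).  When (0:0:1) is very
    singular this forces u_0 and u_1 to have a common factor of degree at least
    3.  That factor is coprime to u_2 and divides u_2 times the X_2-coefficient
    of P, which has degree 2, so this coefficient vanishes
    ([very_singular_syzygy]).  Thus P = p1 X_0 - p0 X_1; here p0 and p1 have no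
    common zero because P belongs to a basis of the syzygies, and u_0 = p0 w,
    u_1 = p1 w with w coprime to u_2.

    _Straightening._  Substitute X_0 = p0 s, X_1 = p1 s, X_2 = 1 ([psi]).  On
    polynomials homogeneous in X this has kernel (P) ([psi_kernel]), and it sends
    K into the multiples of the linear polynomial w - u_2 s ([curve_line_dvd]),
    of which the image q of Q is a unit multiple ([psi_Q_line]).  The operator
    D_T becomes multiplication by s, so F_{2(k-j),j} goes to s^(j-1) q, and up to
    sign F^0_{1,k} and F^1_{1,k} go to l_0 s^(k-1) q and l_1 s^(k-1) q, where l_0
    and l_1 are linearly independent linear forms in T ([bezout_free]).

    _Generation in positive T-degree._  If G in K has bidegree (i,j), its image is
    q times a sum of terms h_l s^l with h_l of degree i - (2k - 2) + 2l in T.  The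
    terms with l < k - 1 come from the F_{2(k-j),j}.  Suppose l = k - 1 + m, so
    that h_l has degree i + 2m.  Every form of degree at least 3 is a combination
    of p0 and p1 ([forms_generated]); hence, if i > 0, the form h_l lies in
    (T_0, T_1) (p0, p1)^m, and h_l s^l q is the image of a combination of
    F^0_{1,k} and F^1_{1,k} ([positive_T_degree]).

    _Generation in T-degree 0._  In K[X], a nonzero homogeneous element of K of
    least degree in X_2 divides the equation E up to a factor in K[X_0, X_1],
    which is a product of linear forms.  Linear forms are prime, and E is
    irreducible, so E itself has least degree in X_2; the same argument then
    shows that E divides every element of K in T-degree 0
    ([curve_generates_kernel]).

    _Minimality._  In a relation expressing one generator by the others, only
    generators of smaller or equal bidegree can occur.  For E and P there are
    none; for F_{2(k-j),j} there is only P, and the image of F_{2(k-j),j} is not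
    0; for F^0_{1,k} there is only F^1_{1,k}, and conversely, and l_0 and l_1 are
    independent ([gens_irredundant]). *)

Set Implicit Arguments.
Unset Strict Implicit.
Unset Printing Implicit Defensive.

Import GRing.Theory.
Local Open Scope ring_scope.

(** * Divisibility and homogeneity *)

Section RingDivisibility.
Variable R : comNzRingType.
Implicit Types x y z : R.

Definition rdvd x y := exists z, y = x * z.

Lemma rdvd0 x : rdvd x 0.
Proof. by exists 0; rewrite mulr0. Qed.

Lemma rdvdD x y z : rdvd x y -> rdvd x z -> rdvd x (y + z).
Proof. by move=> [a ->] [b ->]; exists (a + b); rewrite mulrDr. Qed.

Lemma rdvdMl x y z : rdvd x y -> rdvd x (z * y).
Proof. by move=> [a ->]; exists (z * a); rewrite mulrCA. Qed.

Lemma rdvdMr x y z : rdvd x y -> rdvd x (y * z).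
Proof. by rewrite mulrC; apply: rdvdMl. Qed.

Lemma rdvd_subM x a b c d :
  rdvd x (a - b) -> rdvd x (c - d) -> rdvd x (a * c - b * d).
Proof.
move=> hab hcd; have -> : a * c - b * d = c * (a - b) + b * (c - d) by ring.
by apply: rdvdD; apply: rdvdMl.
Qed.

Lemma rdvd_subX x a b k : rdvd x (a - b) -> rdvd x (a ^+ k - b ^+ k).
Proof.
move=> hab; elim: k => [|k IH]; first by rewrite !expr0 subrr; apply: rdvd0.
by rewrite !exprS; apply: rdvd_subM.
Qed.

End RingDivisibility.

Section MMap.
Variables (n : nat) (R : nzRingType) (S : comNzRingType) (f : {rmorphism R -> S}).

(** Evaluations at congruent points are congruent.  Combined with [mmap_homog], this
    is how a relation between the variables is eliminated in the sequel: multiply by a power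
    of one value to clear denominators, then substitute. *)
Lemma rdvd_mmap (h1 h2 : 'I_n -> S) x (G : {mpoly R[n]}) :
  (forall i, rdvd x (h1 i - h2 i)) -> rdvd x (mmap f h1 G - mmap f h2 G).
Proof.
move=> h12; elim/mpolyind: G => [|c m p _ _ IH].
  by rewrite !mmap0 subrr; apply: rdvd0.
rewrite !mmapD !mmapZ !mmapX opprD addrACA -mulrBr; apply: rdvdD IH.
apply: rdvdMl; rewrite /mmap1.
elim/big_rec2: _ => [|i y1 y2 _ IH]; first by rewrite subrr; apply: rdvd0.
by apply: rdvd_subM IH; apply: rdvd_subX.
Qed.

Lemma mmap_homog (h : 'I_n -> S) c j (G : {mpoly R[n]}) : G \is j.-homog ->
  mmap f (fun i => c * h i) G = c ^+ j * mmap f h G.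
Proof.
move=> hG; rewrite /mmap big_distrr /=; apply: eq_big_seq => m hm.
have <- : mdeg m = j by exact: (dhomogP _ _ _ hG m hm).
rewrite mulrCA; congr (_ * _); rewrite /mmap1 mdegE.
rewrite -prodrXr -big_split /=; apply: eq_bigr => i _; exact: exprMn.
Qed.

Lemma eq_mmap (h1 h2 : 'I_n -> S) (G : {mpoly R[n]}) :
  h1 =1 h2 -> mmap f h1 G = mmap f h2 G.
Proof. by move=> h12; apply: eq_bigr => m _; rewrite (mmap1_eq m h12). Qed.

Lemma mmap_comp (T : comNzRingType) (g : {rmorphism S -> T}) h (G : {mpoly R[n]}) :
  g (mmap f h G) = mmap (g \o f) (g \o h) G.
Proof.
rewrite /mmap rmorph_sum /=; apply: eq_bigr => m _.
rewrite rmorphM /mmap1 rmorph_prod; congr (_ * _).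
by apply: eq_bigr => i _; rewrite rmorphXn.
Qed.

End MMap.

Lemma mmap_id n (R : comNzRingType) (G : {mpoly R[n]}) :
  mmap (@mpolyC n R) (fun i => 'X_i) G = G.
Proof.
by rewrite {2}[G]mpolyE; apply: eq_bigr => m _; rewrite mmap1_id mul_mpolyC.
Qed.

Section HomogQuotient.
Variables (n : nat) (R : idomainType).
Implicit Types a h : {mpoly R[n]}.

Lemma pihomog_sum_all h : h = \sum_(k < msize h) pihomog mdeg k h.
Proof. exact: pihomog_partitionE. Qed.

Lemma pihomogM d a k h : a \is d.-homog ->
  pihomog mdeg (d + k) (a * h) = a * pihomog mdeg k h.
Proof.
move=> ha; elim/mpolyind: h => [|c m p _ _ IH].
  by rewrite mulr0 !pihomog0 mulr0.
rewrite mulrDr !pihomogD IH mulrDr; congr (_ + _).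
rewrite -scalerAr !linearZ /= -scalerAr pihomogX; congr (_ *: _).
have haX : a * 'X_[m] \is (d + mdeg m).-homog by rewrite dhomogM ?dhomogX.
case: eqP => [<-|hm]; first by rewrite pihomog_dE.
by rewrite mulr0 (pihomog_ne0 _ haX) // eqn_add2l; apply/eqP.
Qed.

Lemma pihomogM_small d a k h : a \is d.-homog -> (k < d)%N ->
  pihomog mdeg k (a * h) = 0.
Proof.
move=> ha lt_kd; elim/mpolyind: h => [|c m p _ _ IH].
  by rewrite mulr0 !pihomog0.
rewrite mulrDr pihomogD IH addr0 -scalerAr linearZ /=.
have haX : a * 'X_[m] \is (d + mdeg m).-homog by rewrite dhomogM ?dhomogX.
by rewrite (pihomog_ne0 _ haX) ?scaler0 //; lia.
Qed.

(** Projecting the product to its components shows that each component of the quotient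
    of the wrong degree is killed by [a]. *)
Lemma homog_quotient d a e h : a != 0 -> a \is d.-homog ->
  a * h \is (d + e).-homog -> h \is e.-homog.
Proof.
move=> nz_a ha hah; rewrite (pihomog_sum_all h); apply: rpred_sum => k _.
have [<-|ne_ke] := eqVneq (k : nat) e; first exact: pihomogP.
suff -> : pihomog mdeg k h = 0 by exact: dhomog0.
apply: (mulfI nz_a); rewrite mulr0 -(pihomogM _ _ ha).
by rewrite (pihomog_ne0 _ hah) // eqn_add2l eq_sym.
Qed.

Lemma homog_quotient_small d a e h : a != 0 -> a \is d.-homog ->
  a * h \is e.-homog -> (e < d)%N -> h = 0.
Proof.
move=> nz_a ha hah lt_ed; rewrite (pihomog_sum_all h) big1 // => k _.
apply: (mulfI nz_a); rewrite mulr0 -(pihomogM _ _ ha).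
by rewrite (pihomog_ne0 _ hah) //; lia.
Qed.

Lemma homog0C h : h \is 0.-homog -> h = (h@_0%MM)%:MP.
Proof.
move=> hh; apply/mpolyP => m; rewrite mcoeffC.
have [->|nz_m] := eqVneq m 0%MM; first by rewrite mulr1.
by rewrite mulr0 (dhomog_nemf_coeff hh) // mdeg_eq0.
Qed.

End HomogQuotient.

(** * Binary forms and their zeros *)

Lemma ord2P (i : 'I_2) : i = ord0 \/ i = ord_max.
Proof. by case: i => [[|[|i]] hi] //; [left | right]; apply: val_inj. Qed.

Lemma ord3P (i : 'I_3) : [\/ i = 0, i = 1 | i = ord_max].
Proof.
case: i => [[|[|[|i]]] hi] //;
  [constructor 1 | constructor 2 | constructor 3]; exact: val_inj.
Qed.

Section Lines.
Variable K : closedFieldType.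
Notation KT := {mpoly K[2]}.
Implicit Types (g : KT) (t : 'I_2 -> K).

(** The linear form vanishing at the point [t] of the projective line. *)
Definition line t : KT := t ord_max *: 'X_ord0 - t ord0 *: 'X_ord_max.

(** Restriction to the line through the origin spanned by [t].  Its values lie in a
    domain, so that its kernel, generated by [line t], is prime. *)
Definition ev_line t : KT -> {poly K} :=
  mmap (@polyC K) (fun i => (t i)%:P * 'X).

HB.instance Definition _ t := GRing.RMorphism.on (ev_line t).

Lemma line_homog t : line t \is 1.-homog.
Proof. by rewrite rpredB // rpredZ // dhomogX /= mdeg1. Qed.

Lemma ev_line_line t : ev_line t (line t) = 0.
Proof.
rewrite /ev_line /line mmapB !mmapZ !mmapX !mmap1U; ring.
Qed.

Lemma ev_line_homog t m g : g \is m.-homog -> ev_line t g = g.@[t] *: 'X^m.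
Proof.
move=> hg; rewrite /ev_line (@eq_mmap _ _ _ _ _ (fun i => 'X * (t i)%:P)).
  rewrite (mmap_homog _ _ _ hg) mulrC -mul_polyC; congr (_ * _).
  by rewrite -(mmap_comp idfun polyC).
by move=> i; rewrite mulrC.
Qed.

Lemma meval_line s t : (line t).@[s] = t ord_max * s ord0 - t ord0 * s ord_max.
Proof. by rewrite /line mevalB !mevalZ !mevalXU. Qed.

(** If [t i] is not 0, then modulo [line t] every variable is a scalar multiple of 'X_i,
    and the polynomial becomes its restriction evaluated at a multiple of 'X_i. *)
Lemma ev_line_eq0 t g : nonzero t -> ev_line t g = 0 <-> rdvd (line t) g.
Proof.
move=> [i nz_ti]; split=> [g0|[h ->]]; last by rewrite rmorphM /= ev_line_line mul0r.
pose h2 j : KT := (t j / t i) *: 'X_i.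
have: rdvd (line t) (mmap (@mpolyC 2 K) (fun i => 'X_i) g - mmap (@mpolyC 2 K) h2 g).
  apply: rdvd_mmap => j; have [->|ne_ji] := eqVneq j i.
    by rewrite /h2 divff // scale1r subrr; apply: rdvd0.
  have tiK : (t i)%:MP * ((t i)^-1)%:MP = 1 :> KT.
    by rewrite -mpolyCM divff // mpolyC1.
  rewrite /h2; case: (ord2P j) (ord2P i) ne_ji nz_ti tiK => [] -> [] -> // _ nz_ti tiK;
    rewrite /line -!mul_mpolyC mpolyCM.
  - by exists (((t ord_max)^-1)%:MP); rewrite -[X in X - _]mulr1 -tiK; ring.
  - by exists (- ((t ord0)^-1)%:MP); rewrite -[X in X - _]mulr1 -tiK; ring.
rewrite mmap_id; suff -> : mmap (@mpolyC 2 K) h2 g = 0 by rewrite subr0.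
pose y : KT := (t i)^-1 *: 'X_i.
have := mmap_comp (@polyC K) (horner_alg y) (fun i => (t i)%:P * 'X) g.
rewrite -/(ev_line t g) g0 rmorph0 => e.
rewrite [RHS]e; rewrite /mmap; apply: eq_bigr => m _ /=.
rewrite horner_algC mulr_algl mul_mpolyC; congr (_ *: _); apply: mmap1_eq => j /=.
by rewrite rmorphM /= horner_algC horner_algX mulr_algl /h2 /y scalerA.
Qed.

Lemma line_neq0 t : nonzero t -> line t != 0.
Proof.
move=> [i nz_ti]; apply/eqP => l0; case/eqP: nz_ti.
case: (ord2P i) => ->.
  have := meval_line (fun j => (j == ord_max)%:R) t.
  by rewrite l0 meval0 /= mulr0 mulr1 sub0r => /esym/eqP; rewrite oppr_eq0 => /eqP.
have := meval_line (fun j => (j == ord0)%:R) t.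
by rewrite l0 meval0 /= mulr0 mulr1 subr0 => /esym.
Qed.

Lemma form_at_point t m g : nonzero t -> g \is m.+1.-homog -> g.@[t] = 0 ->
  exists2 g', g' \is m.-homog & g = line t * g'.
Proof.
move=> nz_t hg g0; have : ev_line t g = 0 by rewrite (ev_line_homog _ hg) g0 scale0r.
case/(ev_line_eq0 _ nz_t) => g' e; exists g' => //.
by apply: homog_quotient (line_neq0 nz_t) (line_homog t) _; rewrite -e.
Qed.

Definition bmon m i : 'X_{1..2} := (U_(ord0) *+ (m - i) + U_(ord_max) *+ i)%MM.

(** The binary form of degree [m] with given coefficients; with [bcoef] it identifies
    forms of degree [m] with vectors of length [m.+1], for dimension counts. *)
Definition bform m (c : 'rV[K]_m.+1) : KT := \sum_i c 0 i *: 'X_[bmon m i].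

Definition bcoef m g : 'rV[K]_m.+1 := \row_i g@_(bmon m i).

Lemma bmonE m i : (bmon m i ord0 = m - i)%N * (bmon m i ord_max = i).
Proof. by split; rewrite mnmDE !mulmnE !mnm1E /=; lia. Qed.

Lemma mdeg2 (x : 'X_{1..2}) : mdeg x = (x ord0 + x ord_max)%N.
Proof. by rewrite mdegE big_ord_recl big_ord1; congr (_ + x _)%N; apply: val_inj. Qed.

Lemma bmon_inj m i j : bmon m i = bmon m j -> i = j.
Proof. by move=> /(congr1 (fun x : 'X_{1..2} => x ord_max)); rewrite !bmonE. Qed.

Lemma mdeg_bmon m (i : 'I_m.+1) : mdeg (bmon m i) = m.
Proof. by rewrite mdeg2 !bmonE; have := ltn_ord i; lia. Qed.

Lemma bmonP m (x : 'X_{1..2}) : mdeg x = m -> x = bmon m (x ord_max).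
Proof.
rewrite mdeg2 => hx; apply/mnmP => i; case: (ord2P i) => ->; rewrite !bmonE; lia.
Qed.

Lemma bcoef_linear m : linear (bcoef m).
Proof. by move=> a g h; apply/rowP => i; rewrite !mxE mcoeffD mcoeffZ. Qed.

HB.instance Definition _ m :=
  GRing.isLinear.Build K KT 'rV[K]_m.+1 _ (bcoef m) (@bcoef_linear m).

Lemma bform_linear m : linear (@bform m).
Proof.
move=> a c d; rewrite /bform scaler_sumr -big_split; apply: eq_bigr => i _ /=.
by rewrite !mxE scalerDl scalerA.
Qed.

HB.instance Definition _ m :=
  GRing.isLinear.Build K 'rV[K]_m.+1 KT _ (@bform m) (@bform_linear m).

Lemma bform_homog m c : @bform m c \is m.-homog.
Proof. by apply: rpred_sum => i _; rewrite rpredZ // dhomogX /= mdeg_bmon. Qed.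

Lemma bformK m : cancel (@bform m) (bcoef m).
Proof.
move=> c; apply/rowP => i; rewrite mxE /bform raddf_sum (bigD1 i) //=.
rewrite mcoeffZ mcoeffX eqxx mulr1 big1 ?addr0 // => j ne_ji.
rewrite mcoeffZ mcoeffX; case: eqP => [/bmon_inj e|]; last by rewrite mulr0.
by rewrite (val_inj e) eqxx in ne_ji.
Qed.

Lemma bcoefK m g : g \is m.-homog -> bform (bcoef m g) = g.
Proof.
move=> hg; apply/mpolyP => x; have [hx|ne_x] := eqVneq (mdeg x) m.
  have lt_x : (x ord_max < m.+1)%N by rewrite -hx mdeg2; lia.
  have := congr1 (fun r : 'rV_m.+1 => r 0 (Ordinal lt_x)) (bformK (bcoef m g)).
  by rewrite !mxE /= -bmonP.
by rewrite !(dhomog_nemf_coeff _ ne_x) ?bform_homog.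
Qed.

(** A form without root at (0:1) has full degree as a polynomial in T_1 after T_0 := 1,
    hence a root. *)
Lemma form_root m g : g \is m.+1.-homog -> exists2 t, nonzero t & g.@[t] = 0.
Proof.
move=> hg; pose c i := g@_(bmon m.+1 i); pose p := \poly_(i < m.+2) c i.
have ev_g t : g.@[t] = \sum_(i < m.+2) c i * (t ord0 ^+ (m.+1 - i) * t ord_max ^+ i).
  rewrite -{1}(bcoefK hg) /bform raddf_sum; apply: eq_bigr => i _ /=.
  rewrite mevalZ mxE mevalX big_ord_recl big_ord1 (_ : lift _ _ = ord_max).
    by rewrite !bmonE.
  exact: val_inj.
have [c0|nz_c] := eqVneq (c m.+1) 0.
  exists (fun i : 'I_2 => (i == ord_max)%:R : K); first by exists ord_max; rewrite eqxx oner_neq0.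
  rewrite ev_g big_ord_recr /= c0 mul0r addr0 big1 // => i _.
  by rewrite expr0n subn_eq0 leqNgt ltn_ord mul0r mulr0.
have szp : size p = m.+2 by apply: size_poly_eq.
have /closed_rootP[r /eqP r0] : size p != 1 by rewrite szp.
exists (fun i : 'I_2 => if i == ord0 then 1 else r).
  by exists ord0; rewrite eqxx; apply: oner_neq0.
rewrite ev_g -{}[RHS]r0 horner_poly; apply: eq_bigr => i _ /=.
by rewrite expr1n mul1r.
Qed.

End Lines.

Section Cancellation.
Variable K : closedFieldType.
Notation KT := {mpoly K[2]}.
Implicit Types (g : KT) (t : 'I_2 -> K).

(** The images of linear forms are prime elements.  Together with the splitting of binary
    forms into linear ones, this replaces unique factorization in [D]. *)
Definition lines_prime (D : idomainType) (iota : {rmorphism KT -> D}) :=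
  injective iota /\
  forall t, nonzero t -> forall x y, rdvd (iota (line t)) (x * y) ->
    rdvd (iota (line t)) x \/ rdvd (iota (line t)) y.

Lemma lines_prime_by (D D' : idomainType) (iota : {rmorphism KT -> D})
    (theta : ('I_2 -> K) -> {rmorphism D -> D'}) :
  injective iota ->
  (forall t x, nonzero t -> theta t x = 0 <-> rdvd (iota (line t)) x) ->
  lines_prime iota.
Proof.
move=> inj_iota thetaP; split=> // t nz_t x y.
move=> /(thetaP _ _ nz_t)/eqP; rewrite rmorphM mulf_eq0.
by case/orP=> /eqP /(thetaP _ _ nz_t); [left | right].
Qed.

Lemma lines_prime_poly : @lines_prime {poly KT} (@polyC KT).
Proof.
apply: (lines_prime_by (theta := fun t => map_poly (ev_line t))).
  exact: polyC_inj.
move=> t p nz_t; split=> [|[z ->]]; last first.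
  by rewrite rmorphM /= map_polyC /= ev_line_line mul0r.
elim/poly_ind: p => [_|p c IH]; first exact: rdvd0.
move=> pc0.
have c0 : ev_line t c = 0.
  by have := congr1 (fun q : {poly _} => q`_0) pc0; rewrite coef_map coefD coefMX coefC /= add0r coef0.
move: pc0; rewrite rmorphD rmorphM /= map_polyC /= c0 addr0 map_polyX.
move/eqP; rewrite mulf_eq0 polyX_eq0 orbF => /eqP/IH hp.
apply: rdvdD; first exact: rdvdMr.
by case/(ev_line_eq0 _ nz_t): c0 => z ->; exists z%:P; rewrite polyCM.
Qed.

Lemma lines_prime_id : @lines_prime KT idfun.
Proof.
apply: (lines_prime_by (theta := fun t => ev_line t)) => // t x nz_t; exact: ev_line_eq0.
Qed.

(** Split [y] into linear forms and cancel them one at a time. *)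
Lemma form_cancel (D : idomainType) (iota : {rmorphism KT -> D}) n y (p W : D) :
  lines_prime iota -> y != 0 -> y \is n.-homog ->
  (forall t, nonzero t -> y.@[t] = 0 -> ~ rdvd (iota (line t)) p) ->
  rdvd (iota y) (p * W) -> rdvd (iota y) W.
Proof.
move=> [inj_iota prime_l]; elim: n y p W => [|n IH] y p W nz_y hy hp.
  move=> _; exists (iota (y@_0%MM)^-1%:MP * W).
  have nz_c : y@_0%MM != 0 by apply: contraNneq nz_y => c0; rewrite (homog0C hy) c0.
  by rewrite mulrA -rmorphM {1}(homog0C hy) -mpolyCM divff // rmorph1 mul1r.
have [t nz_t yt0] := form_root hy.
have [y' hy' ey] := form_at_point nz_t hy yt0.
case=> Z e; have [] := prime_l t nz_t p W.
- by exists (iota y' * Z); rewrite e ey rmorphM mulrA.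
- by move/(hp t nz_t yt0).
case=> W1 eW; have nz_l : iota (line t) != 0.
  by rewrite -(rmorph0 iota) (inj_eq inj_iota) line_neq0.
have [|||W2 eW1] := IH y' p W1 _ hy'.
- by apply: contraNneq nz_y => y'0; rewrite ey y'0 mulr0.
- move=> s nz_s y's0; apply: (hp s nz_s).
  by rewrite ey mevalM y's0 mulr0.
- exists Z; apply: (mulfI nz_l).
  by rewrite mulrCA -eW e ey rmorphM mulrA.
by exists W2; rewrite eW eW1 ey rmorphM mulrA.
Qed.

Definition no_common_zero g h := forall t, nonzero t -> ~ (g.@[t] = 0 /\ h.@[t] = 0).

Lemma no_common_zeroC g h : no_common_zero g h -> no_common_zero h g.
Proof. by move=> gh t nz_t [h0 g0]; apply: (gh t nz_t). Qed.

Lemma meval_rdvd_line t g : rdvd (line t) g -> g.@[t] = 0.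
Proof. by case=> z ->; rewrite mevalM meval_line (mulrC (t ord_max)) subrr mul0r. Qed.

Lemma coprime_cancel n y p W : y != 0 -> y \is n.-homog -> no_common_zero y p ->
  rdvd y (p * W) -> rdvd y W.
Proof.
move=> nz_y hy yp; apply: (form_cancel lines_prime_id nz_y hy) => t nz_t y0.
by move/meval_rdvd_line => p0; apply: (yp t nz_t).
Qed.

Lemma no_common_zero_neq0 n g h : g \is n.+1.-homog -> no_common_zero h g -> h != 0.
Proof.
move=> hg gh; apply/eqP => h0; have [t nz_t g0] := form_root hg.
by apply: (gh t nz_t); rewrite h0 meval0.
Qed.

(** Divide by a linear form through a common zero as long as there is one. *)
Lemma form_gcd n u0 u1 : u0 \is n.-homog -> u1 \is n.-homog -> (u0 != 0) || (u1 != 0) ->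
  exists m k h v0 v1, [/\ (m + k = n)%N, h \is m.-homog, v0 \is k.-homog
    & v1 \is k.-homog /\ [/\ u0 = h * v0, u1 = h * v1 & no_common_zero v0 v1]].
Proof.
elim: n u0 u1 => [|n IH] u0 u1 h0 h1 nz.
  exists 0%N, 0%N, 1, u0, u1; split=> //; first exact: dhomog1.
  split=> //; split; rewrite ?mul1r // => t _.
  rewrite (homog0C h0) (homog0C h1) !mevalC => -[e0 e1].
  by move: nz; rewrite (homog0C h0) (homog0C h1) e0 e1 !mpolyC0 eqxx.
have [[t nz_t [u0t u1t]]|no_t] :=
    classic (exists2 t, nonzero t & u0.@[t] = 0 /\ u1.@[t] = 0).
  have [v0 hv0 e0] := form_at_point nz_t h0 u0t.
  have [v1 hv1 e1] := form_at_point nz_t h1 u1t.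
  have [|m [k [h [a [b [<- hh ha [hb [ea eb ab]]]]]]]] := IH v0 v1 hv0 hv1.
    move: nz; rewrite e0 e1; apply: contraLR; rewrite !negb_or !negbK.
    by move=> /andP[/eqP-> /eqP->]; rewrite mulr0 eqxx.
  exists m.+1, k, (line t * h), a, b; split=> //.
    by rewrite -[m.+1]add1n dhomogM ?line_homog.
  by split=> //; split; rewrite // -mulrA -?ea -?eb.
exists 0%N, n.+1, 1, u0, u1; split=> //; first exact: dhomog1.
split=> //; split; rewrite ?mul1r // => t nz_t zt.
by apply: no_t; exists t.
Qed.

(** A syzygy of coprime forms is a multiple of the Koszul one, which has entries of
    higher degree. *)
Lemma syzygy_small n v0 v1 a b : v0 \is n.+1.-homog -> v1 \is n.+1.-homog ->
  no_common_zero v0 v1 -> a \is n.-homog -> b \is n.-homog ->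
  a * v0 + b * v1 = 0 -> a = 0 /\ b = 0.
Proof.
have half x y c d : x \is n.+1.-homog -> y \is n.+1.-homog ->
    no_common_zero x y -> d \is n.-homog -> c * x + d * y = 0 -> d = 0.
  move=> hx hy xy hd e; have nz_x := no_common_zero_neq0 hy xy.
  have [|z ez] := coprime_cancel (W := d) nz_x hx xy.
    exists (- c); apply/eqP; rewrite mulrN -addr_eq0; apply/eqP; rewrite -e; ring.
  rewrite ez in hd *.
  by rewrite (homog_quotient_small nz_x hx hd) ?mulr0.
move=> h0 h1 v01 ha hb e; split; last exact: half e.
by apply: (half v1 v0 b a) => //; [exact: no_common_zeroC | rewrite addrC].
Qed.

(** Since [v0] and [v1] have no common zero, (a, b) |-> a v0 + b v1 is injective on
    pairs of forms of degree n ([syzygy_small]).  Its source and its target, the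
    forms of degree 2 n + 1, both have dimension 2 n + 2, so it is onto. *)
Lemma forms_generated_base n v0 v1 f : v0 \is n.+1.-homog -> v1 \is n.+1.-homog ->
  no_common_zero v0 v1 -> f \is (n + n.+1).-homog ->
  exists a b, [/\ a \is n.-homog, b \is n.-homog & f = a * v0 + b * v1].
Proof.
move=> h0 h1 v01 hf.
pose phi (r : 'rV[K]_(n.+1 + n.+1)) : KT :=
  bform (lsubmx r) * v0 + bform (rsubmx r) * v1.
have phi_homog r : phi r \is (n + n.+1).-homog.
  by rewrite rpredD // dhomogM ?bform_homog.
pose A : 'M[K]_(n.+1 + n.+1) := \matrix_i bcoef (n + n.+1) (phi (delta_mx 0 i)).
have phiA r : r *m A = bcoef (n + n.+1) (phi r).
  rewrite mulmx_sum_row {2}[r]row_sum_delta.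
  under eq_bigr => i _ do rewrite rowK.
  have -> : phi (\sum_j r 0 j *: delta_mx 0 j) = \sum_j r 0 j *: phi (delta_mx 0 j).
    rewrite /phi !linear_sum /= !mulr_suml -big_split; apply: eq_bigr => i _ /=.
    by rewrite !linearZ /= scalerDr !scalerAl.
  by rewrite linear_sum; apply: eq_bigr => i _; rewrite linearZ.
(* The rows of A are the images of the basis vectors under phi. *)
have inj_A : row_free A.
  rewrite -kermx_eq0; apply/eqP/row_matrixP => i; rewrite row0.
  have: row i (kermx A) *m A = 0 by rewrite -row_mul mulmx_ker row0.
  rewrite phiA; set r := row i _ => /(congr1 (@bform K _)).
  rewrite bcoefK // linear0 => /(syzygy_small h0 h1 v01)[]; rewrite ?bform_homog //.
  move=> /(congr1 (bcoef n)) e1 /(congr1 (bcoef n)) e2.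
  by rewrite !bformK !linear0 in e1 e2; rewrite -[r]hsubmxK e1 e2 row_mx0.
have full_A : row_full A by rewrite row_full_unit -row_free_unit.
have := submx_full (bcoef (n + n.+1) f : 'rV_(n.+1 + n.+1)) full_A.
case/submxP => r; rewrite phiA => /(congr1 (@bform K _)); rewrite !bcoefK // => ->.
by exists (bform (lsubmx r)), (bform (rsubmx r)); rewrite !bform_homog.
Qed.

Lemma form_split_var m (f : KT) : f \is m.+1.-homog ->
  exists a b, [/\ a \is m.-homog, b \is m.-homog & f = a * 'X_ord0 + b * 'X_ord_max].
Proof.
move=> hf; exists (\sum_(i < m.+1) f@_(bmon m.+1 i) *: 'X_[bmon m i]).
exists (f@_(bmon m.+1 m.+1) *: 'X_[bmon m m]); split.
- by apply: rpred_sum => i _; rewrite rpredZ // dhomogX /= mdeg_bmon.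
- by rewrite rpredZ // dhomogX /= (mdeg_bmon ord_max).
rewrite -{1}(bcoefK hf) /bform big_ord_recr /= mxE; congr (_ + _).
  rewrite mulr_suml; apply: eq_bigr => i _; rewrite mxE -scalerAl -mpolyXD.
  congr (_ *: 'X_[_]); apply/mnmP => j; have := ltn_ord i.
  by case: (ord2P j) => ->; rewrite mnmDE mnm1E !bmonE /=; lia.
rewrite -scalerAl -mpolyXD; congr (_ *: 'X_[_]); apply/mnmP => j.
by case: (ord2P j) => ->; rewrite mnmDE mnm1E !bmonE /=; lia.
Qed.

(** Reduce to degree 2 n + 1 by multiplying by variables. *)
Lemma forms_generated n v0 v1 r f : v0 \is n.+1.-homog -> v1 \is n.+1.-homog ->
  no_common_zero v0 v1 -> f \is (n + r + n.+1).-homog ->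
  exists a b, [/\ a \is (n + r).-homog, b \is (n + r).-homog & f = a * v0 + b * v1].
Proof.
move=> h0 h1 v01; elim: r f => [|r IH] f hf.
  by rewrite addn0 in hf *; apply: forms_generated_base.
have [|f0 [f1 [hf0 hf1 ->]]] := @form_split_var (n + r + n.+1) f.
  by rewrite -addSn -addnS.
have [a0 [b0 [ha0 hb0 ->]]] := IH _ hf0.
have [a1 [b1 [ha1 hb1 ->]]] := IH _ hf1.
have hX (i : 'I_2) : ('X_i : KT) \is 1.-homog by rewrite dhomogX /= mdeg1.
rewrite addnS -(addn1 (n + r)); exists (a0 * 'X_ord0 + a1 * 'X_ord_max), (b0 * 'X_ord0 + b1 * 'X_ord_max).
split; try by rewrite rpredD // dhomogM.
ring.
Qed.

End Cancellation.

(** * Ternary forms as polynomials in the last variable *)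

Section LastVariable.
Variables (n : nat) (R : idomainType).
Notation S := {mpoly R[n]}.

(** The inverse of [muni], which views a polynomial as univariate in its last variable. *)
Definition unmuni : {poly S} -> {mpoly R[n.+1]} :=
  horner_eval 'X_ord_max \o map_poly (@mwiden n R).

HB.instance Definition _ := GRing.RMorphism.on unmuni.

Lemma unmuniC (c : S) : unmuni c%:P = mwiden c.
Proof. by rewrite /unmuni /= map_polyC /= /horner_eval hornerC. Qed.

Lemma unmuniX : unmuni 'X = 'X_ord_max.
Proof. by rewrite /unmuni /= map_polyX /= /horner_eval hornerX. Qed.

Definition mnmtrunc (m : 'X_{1..n.+1}) : 'X_{1..n} :=
  [multinom m (widen_ord (leqnSn n) i) | i < n].

Lemma mnm_last (m : 'X_{1..n.+1}) :
  m = (mnmwiden (mnmtrunc m) + U_(ord_max) *+ m ord_max)%MM.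
Proof.
apply/mnmP => i; rewrite mnmDE mulmnE mnm1E.
case: (unliftP ord_max i) => [j|] ->.
  have -> : lift ord_max j = widen_ord (leqnSn n) j.
    by apply: val_inj; rewrite /= /bump leqNgt ltn_ord.
  rewrite mnmwiden_widen mnmE; case: eqP => [/(congr1 val)/=|_]; last by rewrite mul0n addn0.
  by move=> e; have := ltn_ord j; rewrite -e ltnn.
by rewrite mnmwiden_ordmax eqxx mul1n.
Qed.

Lemma muniX m : muni ('X_[m] : {mpoly R[n.+1]}) = 'X_[mnmtrunc m] *: 'X^(m ord_max).
Proof. by rewrite muniE msuppX big_seq1 mcoeffX eqxx scale1r. Qed.

Lemma muniK : cancel (@muni n R) unmuni.
Proof.
move=> p; rewrite [RHS]mpolyE [p in LHS]mpolyE (raddf_sum (@muni n R)) (raddf_sum unmuni).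
apply: eq_bigr => m _ /=.
rewrite muniZ muniX -!mul_polyC !rmorphM /= !unmuniC rmorphXn /= unmuniX.
by rewrite mwidenC mul_mpolyC mwidenX mpolyXn -mpolyXD -mnm_last.
Qed.

Lemma muni_last : muni ('X_ord_max : {mpoly R[n.+1]}) = 'X.
Proof.
rewrite muniX mnm1E eqxx expr1 (_ : mnmtrunc _ = 0%MM) ?mpolyX0 ?scale1r //.
apply/mnmP => i; rewrite mnmE mnm1E mnm0E; case: eqP => // /(congr1 val) /=.
by have := ltn_ord i; lia.
Qed.

Lemma muni_widen (c : S) : muni (mwiden c) = c%:P.
Proof.
rewrite [c in RHS]mpolyE [c in LHS]mpolyE (raddf_sum (@mwiden n R)).
rewrite (raddf_sum (@muni n R)) (raddf_sum (@polyC S)); apply: eq_bigr => m _ /=.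
rewrite mwidenZ muniZ mwidenX muniX mnmwiden_ordmax expr0 alg_polyC.
rewrite (_ : mnmtrunc _ = m) -?mul_polyC -?polyCM ?mul_mpolyC //.
by apply/mnmP => i; rewrite mnmE mnmwiden_widen.
Qed.

Lemma unmuniK : cancel unmuni (@muni n R).
Proof.
elim/poly_ind => [|p c IH]; first by rewrite !rmorph0.
by rewrite !rmorphD !rmorphM /= IH unmuniX unmuniC muni_last muni_widen.
Qed.

Lemma muni_unit (p : {mpoly R[n.+1]}) :
  p \is a GRing.unit -> muni p \is a GRing.unit.
Proof.
case/unitrP=> q [qp _]; have e : muni p * muni q = 1 by rewrite mulrC -muniM qp muni1.
by apply/(@unitrPr {poly S}); exists (muni q).
Qed.

(** Homogeneity for the total degree in all variables, read through [unmuni]. *)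
Definition total_homog D (f : {poly S}) := unmuni f \is D.-homog.

Lemma total_homogC D (c : S) : c \is D.-homog -> total_homog D c%:P.
Proof.
move=> /dhomogP hc; rewrite /total_homog unmuniC [c]mpolyE (raddf_sum (@mwiden n R)) big_seq.
apply: rpred_sum => m hm /=; rewrite mwidenZ mwidenX rpredZ // dhomogX /=.
rewrite -(hc m hm) /= !mdegE big_ord_recr /= mnmwiden_ordmax addn0.
by apply/eqP/eq_bigr => i _; rewrite mnmwiden_widen.
Qed.

Lemma total_homogM D D' f g : total_homog D f -> total_homog D' g -> total_homog (D + D') (f * g).
Proof. by rewrite /total_homog rmorphM; apply: dhomogM. Qed.

Lemma total_homogXn l : total_homog l 'X^l.
Proof. by rewrite /total_homog rmorphXn /= unmuniX mpolyXn dhomogX /= mdegMn mdeg1 mul1n. Qed.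

Lemma total_homogD D f g : total_homog D f -> total_homog D g -> total_homog D (f + g).
Proof. by rewrite /total_homog rmorphD; apply: rpredD. Qed.

Lemma total_homogN D f : total_homog D f -> total_homog D (- f).
Proof. by rewrite /total_homog rmorphN => hf; rewrite rpredN. Qed.

Lemma muni_coef (p : {mpoly R[n.+1]}) l x :
  (muni p)`_l@_x = p@_(mnmwiden x + U_(ord_max) *+ l)%MM.
Proof.
rewrite [p in LHS]mpolyE (raddf_sum (@muni n R)) coef_sum raddf_sum /=.
rewrite [in RHS](mpolyE p) raddf_sum; apply: eq_bigr => m _ /=.
rewrite muniZ muniX coefZ coefZ coefXn mcoeffCM mcoeffZ mcoeffX; congr (_ * _).
rewrite mulr_natr mcoeffMn mcoeffX -mulrnA mulnb; congr (_%:R); congr nat_of_bool.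
apply/andP/eqP => [[/eqP <- /eqP ->]|->]; first exact: mnm_last.
split; apply/eqP.
  by apply/mnmP => i; rewrite mnmE mnmDE mulmnE mnm1E mnmwiden_widen -val_eqE /=;
     have := ltn_ord i; lia.
by rewrite mnmDE mulmnE mnm1E mnmwiden_ordmax eqxx; lia.
Qed.

Lemma mdeg_widen_last x l : mdeg (mnmwiden x + U_(ord_max : 'I_n.+1) *+ l)%MM = (mdeg x + l)%N.
Proof.
rewrite mdegD mdegMn mdeg1 mul1n !mdegE big_ord_recr /= mnmwiden_ordmax addn0.
by congr (_ + _)%N; apply: eq_bigr => i _; rewrite mnmwiden_widen.
Qed.

Lemma total_homog_coef D f l : total_homog D f -> (l <= D)%N -> f`_l \is (D - l).-homog.
Proof.
move=> /dhomogP hf le_lD; apply/dhomogP => x; rewrite mcoeff_msupp -[f]unmuniK muni_coef.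
rewrite -mcoeff_msupp => /hf /=; rewrite mdeg_widen_last; lia.
Qed.

Lemma total_homog_coef0 D f l : total_homog D f -> (D < l)%N -> f`_l = 0.
Proof.
move=> hf lt_Dl; apply/mpolyP => x; rewrite mcoeff0 -[f]unmuniK muni_coef.
by rewrite (dhomog_nemf_coeff hf) //= mdeg_widen_last; lia.
Qed.

Lemma total_homog_size D f : total_homog D f -> (size f <= D.+1)%N.
Proof. by move=> hf; apply/leq_sizeP => l lt_Dl; apply: total_homog_coef0 hf _. Qed.

Lemma total_homog_lead D f e : total_homog D f -> size f = e.+1 ->
  (e <= D)%N /\ lead_coef f \is (D - e).-homog.
Proof.
move=> hf sf; have := total_homog_size hf; rewrite sf ltnS => le_eD; split=> //.
by rewrite lead_coefE sf; apply: total_homog_coef hf _.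
Qed.

(** The multiplier is a power of the leading coefficient fixed in advance, so that it
    can be the same for all the dividends of a family, and every step preserves homogeneity. *)
Lemma pseudo_division D DE e (E B : {poly S}) s : total_homog DE E -> size E = e.+1 ->
  total_homog D B -> (size B <= e + s)%N ->
  exists N Q : {poly S}, [/\ (lead_coef E ^+ s)%:P * B = E * N + Q, (size Q <= e)%N
    & total_homog (D + s * (DE - e)) Q].
Proof.
move=> hE sE; have [le_eDE ha] := total_homog_lead hE sE.
elim: s D B => [|s IH] D B hB sB.
  exists 0, B; rewrite expr0 mul1r mulr0 add0r mul0n addn0; split=> //.
  by rewrite addn0 in sB.
set a := lead_coef E in ha *; set b := B`_(e + s).
pose B' := a%:P * B - b%:P * 'X^s * E.
have hB' : total_homog (D + (DE - e)) B'.
  apply: total_homogD; first by rewrite addnC; apply: total_homogM => //; apply: total_homogC.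
  apply: total_homogN; case: (leqP (e + s) D) => [le_D|lt_D].
    have -> : (D + (DE - e) = (D - (e + s)) + s + DE)%N by lia.
    apply: total_homogM hE; apply: total_homogM (total_homogXn s); apply: total_homogC; exact: total_homog_coef.
  rewrite /b (total_homog_coef0 hB) // !mul0r /total_homog rmorph0; exact: dhomog0.
have sB' : (size B' <= e + s)%N.
  apply/leq_sizeP => l le_l; rewrite coefB coefCM -mulrA coefCM coefXnM.
  case: ltnP => [|_]; first by lia.
  have [->|ne_l] := eqVneq l (e + s)%N.
    by rewrite addnK /a lead_coefE sE /= mulrC subrr.
  rewrite [B`_l]nth_default ?[E`_ _]nth_default ?sE ?mulr0 ?subr0 //; first by lia.
  by apply: leq_trans sB _; lia.
have [N [Q [e1 sQ hQ]]] := IH _ _ hB' sB'.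
exists (N + (a ^+ s * b)%:P * 'X^s), Q; split=> //; last first.
  by rewrite mulSn addnA.
have -> : (a ^+ s.+1)%:P * B = (a ^+ s)%:P * B' + (a ^+ s * b)%:P * 'X^s * E.
  by rewrite /B' exprS !polyCM; ring.
by rewrite e1 mulrDr; ring.
Qed.

End LastVariable.

(** * The equation of the curve generates the moving curves of T-degree 0 *)

Section Curve.
Variable K : closedFieldType.
Notation KT := {mpoly K[2]}.
Notation KX := {mpoly K[3]}.
Variable u : 'I_3 -> KT.

(** Substitution of the parametrization in a polynomial in X_2 over K[X_0, X_1]; here the
    two variables of KT stand for X_0 and X_1. *)
Definition param_eval : {poly KT} -> KT :=
  mmap (@mpolyC 2 K) u \o (@unmuni 2 K).

HB.instance Definition _ := GRing.RMorphism.on param_eval.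

Definition param_eval01 : KT -> KT :=
  mmap (@mpolyC 2 K) (fun i => u (widen_ord (leqnSn 2) i)).

HB.instance Definition _ := GRing.RMorphism.on param_eval01.

Lemma param_evalC c : param_eval c%:P = param_eval01 c.
Proof.
rewrite /param_eval /= unmuniC /mwiden mmap_comp /param_eval01.
rewrite /mmap; apply: eq_bigr => m _; rewrite /= mmapC; congr (_ * _).
by apply: mmap1_eq => i /=; rewrite mmapX mmap1U.
Qed.

Lemma param_eval_muni G : param_eval (muni G) = mmap (@mpolyC 2 K) u G.
Proof. by rewrite /param_eval /= muniK. Qed.

(** No nonzero form in X_0, X_1 vanishes on the curve, i.e. u_0 / u_1 is not constant. *)
Definition binary_injective := forall m (c : KT), c != 0 -> c \is m.-homog ->
  param_eval01 c != 0.

(** A linear form dividing a product divides a factor; divide it out.  The first factor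
    only loses factors of degree 0, so its degree in X_2 is unchanged. *)
Lemma strip_form n (y : KT) (F f N : {poly KT}) : y != 0 -> y \is n.-homog -> f != 0 ->
  y%:P * F = f * N -> exists f' N', F = f' * N' /\ size f' = size f.
Proof.
elim: n y f N => [|n IH] y f N nz_y hy nz_f e.
  exists f, (((y@_0%MM)^-1)%:MP%:P * N); split=> //.
  have nz_c : y@_0%MM != 0 by apply: contraNneq nz_y => c0; rewrite (homog0C hy) c0.
  rewrite mulrCA -e mulrA -polyCM {2}(homog0C hy) -mpolyCM mulVf //.
  by rewrite mpolyC1 mul1r.
have [t nz_t yt0] := form_root hy.
have [y' hy' ey] := form_at_point nz_t hy yt0.
have nz_l := line_neq0 nz_t.
have nz_lP : (line t)%:P != 0 :> {poly KT} by rewrite polyC_eq0.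
have nz_y' : y' != 0 by apply: contraNneq nz_y => y'0; rewrite ey y'0 mulr0.
have [|[z ez]|[z ez]] := (@lines_prime_poly K).2 t nz_t f N.
- by exists (y'%:P * F); rewrite -e ey polyCM mulrA.
- have nz_z : z != 0 by apply: contraNneq nz_f => z0; rewrite ez z0 mulr0.
  have [|f' [N' [eF sf]]] := IH y' z N nz_y' hy' nz_z.
    by apply: (mulfI nz_lP); rewrite mulrA -polyCM -ey e ez mulrA.
  by exists f', N'; split=> //; rewrite sf ez size_Cmul.
apply: (IH y' f z nz_y' hy' nz_f).
by apply: (mulfI nz_lP); rewrite mulrA -polyCM -ey e ez mulrCA.
Qed.

Lemma remainder_in_kernel (f g y N Q : {poly KT}) :
  param_eval f = 0 -> param_eval g = 0 -> y * g = f * N + Q -> param_eval Q = 0.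
Proof.
move=> f0 g0 /(congr1 param_eval); rewrite rmorphD !rmorphM /= f0 g0.
by rewrite mulr0 mul0r add0r => <-.
Qed.

Section Principal.
Variables (E : KX) (DE : nat).
Hypotheses (irrE : mirreducible E) (hE : E \is DE.-homog).
Hypotheses (E0 : param_eval (muni E) = 0) (inj01 : binary_injective).

(** A polynomial of size 1 involves X_0 and X_1 only. *)
Lemma kernel_size_gt1 D f : f != 0 -> total_homog D f -> param_eval f = 0 -> (1 < size f)%N.
Proof.
move=> nz_f hf f0; rewrite ltnNge; apply/negP => le1.
have ef := size1_polyC le1; have nz_c : f`_0 != 0.
  by apply: contraNneq nz_f => c0; rewrite ef c0 polyC0.
by have /eqP := inj01 nz_c (total_homog_coef hf (leq0n D)); rewrite -param_evalC -ef.
Qed.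

Lemma total_homog_muni D (G : KX) : G \is D.-homog -> total_homog D (muni G).
Proof. by rewrite /total_homog muniK. Qed.

Lemma muni_irreducible (f g : {poly KT}) : muni E = f * g ->
  f \is a GRing.unit \/ g \is a GRing.unit.
Proof.
case: irrE => _ _ irr e; have [] := irr (unmuni f) (unmuni g).
- by rewrite -[LHS]muniK e rmorphM.
- by move/muni_unit; rewrite unmuniK; left.
- by move/muni_unit; rewrite unmuniK; right.
Qed.

Lemma unit_size1 (f : {poly KT}) : f \is a GRing.unit -> size f = 1%N.
Proof. by rewrite poly_unitE => /andP[/eqP]. Qed.

Lemma muni_neq0 : muni E != 0.
Proof.
case: irrE => nz_E _ _; apply: contraNneq nz_E => e0.
by rewrite -[E]muniK e0 rmorph0.
Qed.

(** Let [f] in the kernel have least degree in X_2.  The remainder of the pseudo-division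
    of E by [f] is 0, so [f] divides E up to a form in X_0, X_1, and irreducibility of E leaves
    no room for a smaller degree. *)
Lemma curve_size_min D f : f != 0 -> total_homog D f -> param_eval f = 0 ->
  (size (muni E) <= size f)%N.
Proof.
have [n] := ubnP (size f); elim: n D f => // n IH D f le_n nz_f hf f0.
have sz1 := kernel_size_gt1 nz_f hf f0.
have [e sf] : exists e, size f = e.+1 by exists (size f).-1; rewrite prednK // ltnW.
have [|N [Q [e1 sQ hQ]]] :=
  @pseudo_division _ _ DE D e f (muni E) (size (muni E)) hf sf (total_homog_muni hE).
  exact: leq_addl.
have [Q0|nz_Q] := eqVneq Q 0; last first.
  have Qev := remainder_in_kernel f0 E0 e1.
  have lt_Qf : (size Q < size f)%N by rewrite sf ltnS.
  by apply: leq_trans (IH _ _ (leq_trans lt_Qf le_n) nz_Q hQ Qev) (ltnW lt_Qf).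
have [_ ha] := total_homog_lead hf sf.
have [|f' [N' [eE sf']]] := strip_form _ (dhomogMn (size (muni E)) ha) nz_f
    (etrans e1 (eq_trans (congr1 _ Q0) (addr0 _))).
  by rewrite expf_neq0 // lead_coef_eq0.
have [/unit_size1|/unit_size1 sN'] := muni_irreducible eE.
  by rewrite sf' => s1; rewrite s1 in sz1.
have nz_f' : f' != 0 by rewrite -size_poly_eq0 sf' -lt0n ltnW.
have nz_N' : N' != 0 by rewrite -size_poly_eq0 sN'.
by rewrite eE size_mul // sN' addn1 sf'.
Qed.

(** By minimality of its degree in X_2, E divides every kernel element up to a form in
    X_0, X_1; that form can be cancelled because E, which involves
    X_2, has no linear factor in X_0, X_1. *)
Lemma curve_generates_kernel D (G : KX) : G \is D.-homog ->
  param_eval (muni G) = 0 -> rdvd E G.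
Proof.
move=> hG G0; have hE' := total_homog_muni hE.
have sz1 := kernel_size_gt1 muni_neq0 hE' E0.
have [e sE] : exists e, size (muni E) = e.+1 by exists (size (muni E)).-1; rewrite prednK // ltnW.
have [|N [Q [e1 sQ hQ]]] :=
  @pseudo_division _ _ D DE e (muni E) (muni G) (size (muni G)) hE' sE (total_homog_muni hG).
  exact: leq_addl.
have Q0 : Q = 0.
  apply/eqP/negPn/negP => nz_Q.
  have Qev := remainder_in_kernel E0 G0 e1.
  by have := curve_size_min nz_Q hQ Qev; rewrite sE leqNgt ltnS sQ.
have [_ ha] := total_homog_lead hE' sE.
rewrite {}Q0 addr0 in e1.
have nz_y : lead_coef (muni E) ^+ size (muni G) != 0.
  by rewrite expf_neq0 // lead_coef_eq0 muni_neq0.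
have [||z ez] := form_cancel (p := muni E) (W := N) (@lines_prime_poly K)
    nz_y (dhomogMn (size (muni G)) ha).
- move=> t nz_t _ [z ez].
  have [|/unit_size1 sz] := muni_irreducible ez; last first.
    by move: sz1; rewrite ez size_Cmul ?line_neq0 // sz.
  rewrite poly_unitE coefC /= => /andP[_ ul].
  have : ev_line t (line t) \is a GRing.unit by exact: rmorph_unit.
  by rewrite ev_line_line unitr0.
- by exists (muni G); rewrite -e1.
exists (unmuni z); apply: (can_inj (@muniK 2 K)).
rewrite muniM unmuniK; apply: (mulfI (_ : (lead_coef (muni E) ^+ size (muni G))%:P != 0)).
  by rewrite polyC_eq0.
by rewrite e1 ez mulrCA.
Qed.

End Principal.
End Curve.

(** * The projection from (0:0:1) *)

Section DegreeBound.
Variable K : closedFieldType.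
Notation KT := {mpoly K[2]}.
Notation KX := {mpoly K[3]}.
Variables (u : 'I_3 -> KT) (h v0 v1 : KT) (n' : nat).
Hypotheses (nz_h : h != 0) (hv0 : v0 \is n'.+1.-homog) (hv1 : v1 \is n'.+1.-homog).
Hypotheses (v01 : no_common_zero v0 v1).
Hypotheses (u0 : u (widen_ord (leqnSn 2) ord0) = h * v0).
Hypotheses (u1 : u (widen_ord (leqnSn 2) ord_max) = h * v1).

Lemma param_eval01X i : param_eval01 u 'X_i = u (widen_ord (leqnSn 2) i).
Proof. by rewrite /param_eval01 mmapX mmap1U. Qed.

(** A form in v0, v1 splits into combinations t_1 v0 - t_0 v1, and such a combination
    can only vanish if v0 and v1 have a common zero. *)
Lemma coprime_pair_binary_injective : binary_injective u.
Proof.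
elim=> [|m IH] c nz_c hc.
  rewrite (homog0C hc) /param_eval01 mmapC.
  by apply: contraNneq nz_c => c0; rewrite (homog0C hc) c0.
have [t nz_t ct0] := form_root hc.
have [c' hc' ec] := form_at_point nz_t hc ct0.
have nz_c' : c' != 0 by apply: contraNneq nz_c => c0; rewrite ec c0 mulr0.
rewrite ec rmorphM; apply: mulf_neq0; last exact: IH.
rewrite /line -!mul_mpolyC rmorphB !rmorphM /= !param_eval01X u0 u1 /param_eval01 !mmapC.
rewrite !(mulrCA _ h) -mulrBr; apply: mulf_neq0 => //.
apply/eqP => e.
have {}e s : t ord_max * v0.@[s] = t ord0 * v1.@[s].
  have := congr1 (meval s) e; rewrite mevalB !mevalM !mevalC.
  by move/eqP; rewrite subr_eq0 => /eqP.
have root_of (i : 'I_2) (x y : KT) : x \is n'.+1.-homog -> no_common_zero x y ->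
    (forall s, x.@[s] = 0 -> t i * y.@[s] = 0) -> t i = 0.
  move=> hx xy exy; have [s nz_s xs0] := form_root hx.
  have /eqP := exy s xs0; rewrite mulf_eq0 => /orP[/eqP //|/eqP ys0].
  by case: (xy s nz_s).
case: nz_t => i /eqP; apply; case: (ord2P i) => ->.
  by apply: (root_of _ v0 v1) => // s e0; rewrite -e e0 mulr0.
apply: (root_of _ v1 v0 hv1 (no_common_zeroC v01)) => // s e0.
by rewrite e e0 mulr0.
Qed.

Variables (E : {poly KT}) (DE e a : nat) (A0 A1 : {poly KT}) (g : KT).
Hypotheses (hE : total_homog DE E) (sE : size E = e.+1) (E0 : param_eval u E = 0).
Hypotheses (hA0 : total_homog a A0) (hA1 : total_homog a A1) (nz_g : g != 0).
Hypotheses (A0u : param_eval u A0 = g * 'X_ord0) (A1u : param_eval u A1 = g * 'X_ord_max).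

(** Since [A0] and [A1] restrict to T_0 and T_1 up to the factor [g], every form in T is,
    up to a power of [g], the restriction of a form in X. *)
Lemma lift_form m (f : KT) : f \is m.-homog ->
  exists2 B, total_homog (m * a) B & param_eval u B = g ^+ m * f.
Proof.
elim: m f => [|m IH] f hf.
  exists f%:P; first exact: total_homogC.
  by rewrite expr0 mul1r param_evalC (homog0C hf) /param_eval01 mmapC.
have [x [y [hx hy ->]]] := form_split_var hf.
have [Bx hBx ex] := IH _ hx; have [By hBy ey] := IH _ hy.
exists (Bx * A0 + By * A1).
  by rewrite mulSn addnC; apply: total_homogD; apply: total_homogM.
by rewrite rmorphD !rmorphM /= A0u A1u ex ey exprS; ring.
Qed.

Let s := (n' * a).+1.
Let al := param_eval01 u (lead_coef E).
Let D0 := (n' * a + s * (DE - e))%N.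

(** Reduce the lifts of the forms of degree n' modulo E, and climb from there with
    [forms_generated], multiplying by X_0 and X_1 only, which does not affect the degree in X_2.
    The multiplier thus depends on [N] only through a power of [h]. *)
Lemma lift_form_reduced N (f : KT) : f \is (n' + N * n'.+1).-homog ->
  exists R : {poly KT}, [/\ (size R <= e)%N, total_homog (D0 + N) R
    & param_eval u R = al ^+ s * g ^+ n' * h ^+ N * f].
Proof.
elim: N f => [|N IH] f hf.
  rewrite mul0n addn0 in hf; have [B hB eB] := lift_form hf.
  have [|N [R [e1 sR hR]]] := pseudo_division (s := s) hE sE hB.
    by apply: leq_trans (total_homog_size hB) _; apply: leq_addl.
  exists R; rewrite addn0; split=> //.
  move/(congr1 (param_eval u)): e1; rewrite rmorphD !rmorphM /= E0 eB mul0r add0r => <-.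
  by rewrite param_evalC rmorphXn expr0 mulr1 mulrA.
have [|x [y [hx hy ->]]] := forms_generated (r := (N * n'.+1)%N) (f := f) hv0 hv1 v01.
  by rewrite -addnA (addnC _ n'.+1) -mulSn.
have [Rx [sx hRx ex]] := IH _ hx; have [Ry [sy hRy ey]] := IH _ hy.
have hX (i : 'I_2) : total_homog 1 ('X_i : KT)%:P by apply: total_homogC; rewrite dhomogX /= mdeg1.
exists (('X_ord0 : KT)%:P * Rx + ('X_ord_max : KT)%:P * Ry); split.
- rewrite (leq_trans (size_polyD _ _)) // geq_max !size_Cmul ?sx ?sy //;
    by rewrite -msize_poly_eq0 msizeX.
- by rewrite addnS -(add1n (D0 + N)); apply: total_homogD; apply: total_homogM.
rewrite rmorphD !rmorphM /= !param_evalC !param_eval01X u0 u1 ex ey exprS; ring.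
Qed.

(** Up to the common factor [h], the projection from (0:0:1) is given by two coprime
    forms of degree n' + 1.  The map [lift_form_reduced] embeds the forms of degree n' + N (n' + 1), a space
    of dimension (n' + 1) (N + 1), in the span of the monomials of degree D0 + N
    whose exponent in X_2 is less than e.  The dimension of the latter grows like
    e N, so letting N grow gives n' + 1 <= e. *)
Lemma projection_degree_le : (n' < e)%N.
Proof.
rewrite ltnNge; apply/negP => le_en.
(* For this N one has n' (D0 + N + 1) < (n' + 1) (N + 1), so C has more rows than columns. *)
pose N := (n' * D0)%N; pose M := (n' + N * n'.+1)%N; pose L := (D0 + N).+1.
have al_neq0 : al != 0.
  have [le_eD hlead] := total_homog_lead hE sE.
  apply: (coprime_pair_binary_injective _ hlead).
  by rewrite lead_coef_eq0 -size_poly_eq0 sE.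
pose c0 := al ^+ s * g ^+ n' * h ^+ N.
have nz_c0 : c0 != 0 by rewrite !mulf_neq0 ?expf_neq0.
have exR (i : 'I_M.+1) : exists R : {poly KT}, [/\ (size R <= e)%N, total_homog (D0 + N) R
    & param_eval u R = c0 * bform (delta_mx 0 i : 'rV_M.+1)].
  by apply: lift_form_reduced; apply: bform_homog.
have [R HR] := fin_all_exists exR.
pose C : 'M[K]_(M.+1, e * L) := \matrix_i
  mxvec (\matrix_(l < e, j < L) (R i)`_l@_(bmon (D0 + N - l) j)).
have : kermx C != 0.
  rewrite kermx_eq0 /row_free neq_ltn; apply/orP; left.
  apply: leq_ltn_trans (rank_leq_col C) _.
  apply: (@leq_ltn_trans (n' * L)%N); first by rewrite leq_mul2r le_en orbT.
  by rewrite /L /M /N; nia.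
case/eqP; apply/row_matrixP => r; rewrite row0.
have: row r (kermx C) *m C = 0 by rewrite -row_mul mulmx_ker row0.
move: (row r _) => x xC.
pose T := \sum_i (x 0 i)%:MP%:P * R i.
have T0 : T = 0.
  apply/polyP => l; rewrite coef0 coef_sum.
  have [le_el|lt_le] := leqP e l.
    rewrite big1 // => i _; rewrite coefCM nth_default ?mulr0 //.
    by case: (HR i) => sR _ _; apply: leq_trans sR le_el.
  have [lt_Dl|le_lD] := ltnP (D0 + N) l.
    rewrite big1 // => i _; case: (HR i) => _ hR _.
    by rewrite coefCM (total_homog_coef0 hR) ?mulr0.
  set G := \sum_i _; have hG : G \is (D0 + N - l).-homog.
    apply: rpred_sum => i _; rewrite coefCM mul_mpolyC rpredZ //.
    by case: (HR i) => _ hR _; apply: total_homog_coef hR _.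
  rewrite -(bcoefK hG) (_ : bcoef _ G = 0) ?linear0 //.
  apply/rowP => j; rewrite !mxE /G raddf_sum /=.
  have lt_jL : (j < L)%N by apply: leq_trans (ltn_ord j) _; rewrite ltnS leq_subr.
  have := congr1 (fun A : 'rV_(e * L) => A 0 (mxvec_index (Ordinal lt_le) (Ordinal lt_jL))) xC.
  rewrite !mxE => xC0; rewrite -[RHS]xC0; apply: eq_bigr => i _.
  by rewrite coefCM mcoeffCM mxE mxvecE mxE.
have := congr1 (param_eval u) T0; rewrite /T rmorph_sum rmorph0 /=.
under eq_bigr => i _.
  rewrite rmorphM /=; case: (HR i) => _ _ ->.
  rewrite param_evalC /param_eval01 mmapC mulrCA mul_mpolyC -linearZ; over.
rewrite -mulr_sumr -linear_sum /= -row_sum_delta => /eqP.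
rewrite mulf_eq0 (negbTE nz_c0) /= => /eqP /(congr1 (bcoef M)).
by rewrite bformK linear0.
Qed.

End DegreeBound.

(** * The moving line of degree 2 at a very singular point *)

Section VerySingular.
Variable K : closedFieldType.
Notation KT := {mpoly K[2]}.
Notation KX := {mpoly K[3]}.

(** The polynomial [p + 1] has no root, so it is constant. *)
Lemma poly_eq0_of_roots (p : {poly K}) : (forall r, p.[r] = 0) -> p = 0.
Proof.
move=> p0; have [/eqP|s1] := boolP (size (p + 1) == 1%N).
  move/eqP => s1; have e1 := size1_polyC (eq_leq (eqP s1)).
  have := congr1 (fun q : {poly K} => q.[0]) e1.
  rewrite !hornerE p0 add0r => e2; move: e1; rewrite -{}e2 polyC1.
  by rewrite -[RHS]add0r => /addIr.
have /closed_rootP[r] := s1; rewrite /root !hornerE p0 add0r.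
by rewrite oner_eq0.
Qed.

Lemma form_eq0 m (g : KT) : g \is m.-homog -> (forall t, nonzero t -> g.@[t] = 0) -> g = 0.
Proof.
move=> hg g0; have e0 : \poly_(i < m.+1) g@_(bmon m i) = 0.
  apply: poly_eq0_of_roots => r; rewrite horner_poly.
  pose t (i : 'I_2) : K := if i == ord0 then 1 else r.
  have nz_t : nonzero t by exists ord0; rewrite /t eqxx oner_neq0.
  rewrite -[RHS](g0 t nz_t) -[in RHS](bcoefK hg) /bform raddf_sum.
  apply: eq_bigr => i _ /=; rewrite mevalZ mxE mevalX big_ord_recl big_ord1 /t /= expr1n mul1r.
  by rewrite (_ : lift _ _ = ord_max) ?bmonE //; apply: val_inj.
rewrite -(bcoefK hg) (_ : bcoef m g = 0) ?linear0 //; apply/rowP => i.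
have := congr1 (fun p : {poly K} => p`_i) e0.
by rewrite coef_poly ltn_ord coef0 !mxE.
Qed.

Lemma mmap_form_homog n d e (u : 'I_n -> KT) (G : {mpoly K[n]}) :
  (forall i, u i \is d.-homog) -> G \is e.-homog ->
  mmap (@mpolyC 2 K) u G \is (e * d).-homog.
Proof.
move=> hu /dhomogP hG; rewrite /mmap big_seq; apply: rpred_sum => m /hG /= <-.
rewrite mul_mpolyC rpredZ // /mmap1 mdegE big_distrl /=.
elim/big_rec2: _ => [|i x y _ hy]; first exact: dhomog1.
by apply: dhomogM => //; rewrite mulnC; apply: dhomogMn.
Qed.

Lemma meval_mmap n (u : 'I_n -> KT) (G : {mpoly K[n]}) t :
  (mmap (@mpolyC 2 K) u G).@[t] = G.@[eval_map u t].
Proof.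
rewrite (mmap_comp _ (meval t)) /meval /mmap; apply: eq_bigr => m _ /=.
by rewrite -/(meval t _) mevalC.
Qed.

Section Param.
Variables (d : nat) (u : 'I_3 -> KT).
Hypotheses (d_gt0 : (0 < d)%N) (hu : parametrization d u).

Lemma param_homog i : u i \is d.-homog. Proof. by case: hu. Qed.

Lemma param_no_common_zero t : nonzero t -> exists i, (u i).@[t] != 0.
Proof.
move=> nz_t; apply: NNPP => none.
have ul : line t \is a GRing.unit.
  apply: hu.2 => i; have hi := param_homog i; rewrite -(prednK d_gt0) in hi.
  have [|h _ ->] := form_at_point nz_t hi; last by exists h; rewrite mulrC.
  by apply/eqP/negPn/negP => nz; apply: none; exists i.
have : ev_line t (line t) \is a GRing.unit by exact: rmorph_unit.
by rewrite ev_line_line unitr0.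
Qed.

Lemma param_neq0 t : nonzero t -> nonzero (eval_map u t).
Proof. exact: param_no_common_zero. Qed.

Lemma on_curve_param t : nonzero t -> on_curve u (eval_map u t).
Proof. by move=> nz_t; exists t => //; exists 1; [exact: oner_neq0 | move=> i; rewrite mul1r]. Qed.

Lemma equation_vanishes E : curve_equation u d E -> mmap (@mpolyC 2 K) u E = 0.
Proof.
move=> [_ hE zE]; apply: (form_eq0 (mmap_form_homog param_homog hE)) => t nz_t.
rewrite meval_mmap; apply/(zE _ (param_neq0 nz_t)); exact: on_curve_param.
Qed.

Lemma meval_homogZ n c (x : 'I_n -> K) e (G : {mpoly K[n]}) : G \is e.-homog ->
  G.@[fun i => c * x i] = c ^+ e * G.@[x].
Proof. by move=> hG; rewrite /meval (mmap_homog _ _ _ hG). Qed.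

(** Along the curve the inverse rational map returns the parameter up to a scalar
    depending on the point.  As T_0 and T_1 are coprime, these scalars are the
    values of a form [g]. *)
Lemma proper_inverse : proper_param u -> exists e (A : 'I_2 -> KX) (g : KT),
  [/\ forall i, A i \is e.-homog, g != 0
    & forall i, mmap (@mpolyC 2 K) u (A i) = g * 'X_i].
Proof.
move=> [e [A [hA [x [t nz_t [c nz_c ex]] nz_Ax] inv _]]].
pose a i := mmap (@mpolyC 2 K) u (A i).
have ha i : a i \is (e * d).-homog by apply: mmap_form_homog (hA i); exact: param_homog.
have hX (i : 'I_2) : ('X_i : KT) \is 1.-homog by rewrite dhomogX /= mdeg1.
have eq_a : a ord0 * 'X_ord_max = a ord_max * 'X_ord0.
  apply/eqP; rewrite -subr_eq0; apply/eqP.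
  apply: (@form_eq0 (e * d + 1)); first by rewrite rpredB // dhomogM.
  move=> s nz_s; rewrite mevalB !mevalM !mevalXU !meval_mmap.
  have [nz_A|] := classic (nonzero (eval_map A (eval_map u s))).
    have [b nz_b eb] := inv s nz_s nz_A.
    by rewrite -/(eval_map A _ ord0) -/(eval_map A _ ord_max) !eb; ring.
  move=> zA; have z i : (A i).@[eval_map u s] = 0.
    by apply/eqP/negPn/negP => nz; apply: zA; exists i.
  by rewrite !z !mul0r subrr.
have [|||g eg] := @coprime_cancel K 1 'X_ord0 'X_ord_max (a ord0) _ (hX _).
- by rewrite -msize_poly_eq0 msizeX.
- move=> s [i nz_si]; rewrite !mevalXU => -[s0 s1].
  by case: (ord2P i) nz_si => ->; rewrite ?s0 ?s1 eqxx.
- by exists (a ord_max); rewrite mulrC eq_a mulrC.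
exists e, A, g; split=> //.
  apply: contraTneq isT => g0; case: nz_Ax => i /eqP; case.
  have a0 : a ord0 = 0 by rewrite eg g0 mulr0.
  have a1 : a ord_max = 0.
    apply/eqP; move/eqP: eq_a; rewrite a0 mul0r eq_sym mulf_eq0 => /orP[//|].
    by rewrite -msize_poly_eq0 msizeX.
  have ai : a i = 0 by case: (ord2P i) => ->.
  rewrite /eval_map (_ : (A i).@[x] = (A i).@[fun j => c * eval_map u t j]).
    by rewrite (meval_homogZ _ _ (hA i)) -meval_mmap -/(a i) ai meval0 mulr0.
  by apply: meval_eq => j; rewrite ex.
move=> i; case: (ord2P i) => ->; first by rewrite -/(a ord0) eg mulrC.
have nz_X0 : ('X_ord0 : KT) != 0 by rewrite -msize_poly_eq0 msizeX.
by apply: (mulfI nz_X0); rewrite mulrC -eq_a eg; ring.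
Qed.

End Param.

Lemma morder_le n (f : {mpoly K[n]}) m : m \in msupp f -> (morder f <= mdeg m)%N.
Proof.
rewrite /morder; elim: (msupp f) => // x s IH; rewrite inE big_cons geq_min.
by case/orP => [/eqP->|/IH ->]; rewrite ?leqnn ?orbT.
Qed.

(** Setting X_2 = 1 forgets the last exponent of each monomial. *)
Lemma local_equation_pt001 (E : KX) : local_equation E ord_max (@pt001 K) =
  \sum_(m <- msupp E) E@_m *: 'X_[mnmwiden (mnmtrunc m)].
Proof.
rewrite /local_equation /comp_mpoly /mmap; apply: eq_bigr => m _.
rewrite mul_mpolyC; congr (_ *: _); rewrite /mmap1 mpolyXE_id big_ord_recr [RHS]big_ord_recr.
rewrite /= mnmwiden_ordmax expr0 tnth_mktuple eqxx add0r /pt001 eqxx mpolyC1 expr1n.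
congr (_ * _); apply: eq_bigr => i _; rewrite tnth_mktuple mnmwiden_widen mnmE.
have /negbTE ne : widen_ord (leqnSn 2) i != ord_max.
  by rewrite -val_eqE /= neq_ltn ltn_ord.
by rewrite ne mpolyC0 addr0.
Qed.

(** In a form of degree d, a monomial of degree l in X_2 contributes a monomial of degree
    d - l to the local equation, and distinct monomials give distinct contributions. *)
Lemma very_singular_size u d (E : KX) mu : E \is d.-homog -> (mu <= d)%N ->
  very_singular u E mu (@pt001 K) -> (size (muni E) <= d - mu)%N.
Proof.
move=> hE le_mu [_ [i nz_i]]; have -> : i = ord_max.
  by apply/eqP; move: nz_i; rewrite /pt001; case: (i == _) => //; rewrite eqxx.
move=> lt_mu; apply/leq_sizeP => l le_l; apply/mpolyP => x.
rewrite muni_coef mcoeff0; apply/eqP/negPn/negP => nz.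
have /= := dhomogP _ _ _ hE (mnmwiden x + U_(ord_max) *+ l)%MM.
rewrite mcoeff_msupp => /(_ nz); rewrite mdeg_widen_last => ed.
have : mnmwiden x \in msupp (local_equation E ord_max (@pt001 K)).
  rewrite mcoeff_msupp local_equation_pt001 raddf_sum /=.
  rewrite (bigD1_seq (mnmwiden x + U_(ord_max) *+ l)%MM) ?msupp_uniq ?mcoeff_msupp //=.
  rewrite mcoeffZ mcoeffX.
  have -> : mnmtrunc (mnmwiden x + U_(ord_max) *+ l)%MM = x.
    apply/mnmP => j; rewrite mnmE mnmDE mulmnE mnm1E mnmwiden_widen -val_eqE /=.
    by rewrite gtn_eqF ?ltn_ord // mul0n addn0.
  rewrite eqxx mulr1 big_seq_cond big1 ?addr0 // => m /andP[ms ne_m].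
  rewrite mcoeffZ mcoeffX; case: eqP => [em|_]; last by rewrite mulr0.
  case/eqP: ne_m; rewrite [LHS]mnm_last em; congr (_ + _ *+ _)%MM.
  have := dhomogP _ _ _ hE m ms; rewrite /= {1}[m]mnm_last em mdeg_widen_last; lia.
move/morder_le; rewrite leqNgt => /negP; apply; apply: leq_trans lt_mu.
have := mdeg_widen_last x 0; rewrite mulm0n addm0 addn0 => ->; lia.
Qed.

(** The common factor [h] of u_0 and u_1 has degree at least 3 by [projection_degree_le],
    and it divides b_2 u_2 while being coprime to u_2; but b_2 has degree 2. *)
Lemma very_singular_syzygy u d (E : KX) (b : 'I_3 -> KT) : (6 <= d)%N ->
  parametrization d u -> proper_param u -> curve_equation u d E ->
  very_singular u E 2 (@pt001 K) -> (forall i, b i \is 2.-homog) ->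
  b 0 * u 0 + b 1 * u 1 + b ord_max * u ord_max = 0 -> b ord_max = 0.
Proof.
move=> d6 hu hproper hE hsing hb syz.
have d_gt0 : (0 < d)%N by apply: leq_trans d6.
have hud := param_homog hu.
have nz_u : (u 0 != 0) || (u 1 != 0).
  rewrite -negb_and; apply/negP => /andP[/eqP e0 /eqP e1].
  have hm := hud ord_max; rewrite -(prednK d_gt0) in hm.
  have [t nz_t um] := form_root hm; have [i] := param_no_common_zero d_gt0 hu nz_t.
  by case: (ord3P i) => ->; rewrite ?e0 ?e1 ?meval0 ?um eqxx.
have [m [n [h [v0 [v1 [emn hh hv0 [hv1 [eu0 eu1 v01]]]]]]]] := form_gcd (hud 0) (hud 1) nz_u.
have nz_h : h != 0 by apply: contraTneq nz_u => h0; rewrite eu0 eu1 h0 !mul0r eqxx.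
have lt2m : (2 < m)%N.
  case: n hv0 hv1 emn => [|n] hv0 hv1 emn; first by rewrite -emn addn0 in d6; lia.
  have [irrE hEd _] := hE.
  have E0 : param_eval u (muni E) = 0 by rewrite param_eval_muni (equation_vanishes d_gt0 hu).
  have sE := very_singular_size hEd (leq_trans (isT : 2 <= 6)%N d6) hsing.
  have [e se] : exists e, size (muni E) = e.+1.
    by exists (size (muni E)).-1; rewrite prednK // lt0n size_poly_eq0 (muni_neq0 irrE).
  have [a [A [g [hA nz_g eA]]]] := proper_inverse hu hproper.
  have u0 : u (widen_ord (leqnSn 2) ord0) = h * v0.
    by rewrite -eu0; congr u; apply: val_inj.
  have u1 : u (widen_ord (leqnSn 2) ord_max) = h * v1.
    by rewrite -eu1; congr u; apply: val_inj.
  have eval_A i : param_eval u (muni (A i)) = g * 'X_i by rewrite param_eval_muni eA.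
  have lt_ne := projection_degree_le nz_h hv0 hv1 v01 u0 u1 (total_homog_muni hEd) se E0
    (total_homog_muni (hA ord0)) (total_homog_muni (hA ord_max)) nz_g (eval_A ord0) (eval_A ord_max).
  by rewrite se in sE; lia.
have [||z ez] := coprime_cancel (p := u ord_max) (W := b ord_max) nz_h hh.
- move=> t nz_t [h0 um]; have [i] := param_no_common_zero d_gt0 hu nz_t.
  by case: (ord3P i) => ->; rewrite ?eu0 ?eu1 ?mevalM ?h0 ?mul0r ?um eqxx.
- exists (- (b 0 * v0 + b 1 * v1)); apply/eqP; rewrite -subr_eq0; apply/eqP.
  by rewrite -[RHS]syz eu0 eu1; ring.
have := hb ord_max; rewrite ez => hz.
by rewrite (homog_quotient_small nz_h hh hz) ?mulr0.
Qed.

End VerySingular.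

(** * Restriction to the pencil of lines through (0:0:1) *)

Definition vec3 (S : Type) (a b c : S) (i : 'I_3) : S :=
  if i == 0 then a else if i == 1 then b else c.

Lemma prod3 (S : comNzRingType) (F : 'I_3 -> S) :
  \prod_i F i = F 0 * F 1 * F ord_max.
Proof.
rewrite !big_ord_recl big_ord0 mulr1 mulrA; congr (F _ * F _ * F _); exact: val_inj.
Qed.

Lemma mdeg3 (m : 'X_{1..3}) : mdeg m = (m 0%R + m 1%R + m ord_max)%N.
Proof.
rewrite mdegE !big_ord_recl big_ord0 addn0 addnA; congr (m _ + m _ + m _)%N; exact: val_inj.
Qed.

Lemma mmap1_vec3 (S : comNzRingType) (a b c : S) m :
  mmap1 (vec3 a b c) m = a ^+ m 0 * b ^+ m 1 * c ^+ m ord_max.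
Proof. by rewrite /mmap1 prod3. Qed.

Lemma mpoly_divisible n (R : comNzRingType) (c : R) (W : {mpoly R[n]}) :
  (forall m, rdvd c W@_m) -> exists W', W = c *: W'.
Proof.
elim/mpolyind: W => [_|a m p hm _ IH hc]; first by exists 0; rewrite scaler0.
have [|p' ep] := IH.
  move=> x; have := hc x; rewrite mcoeffD mcoeffZ mcoeffX.
  have [<- _|_] := eqVneq m x; last by rewrite mulr0 add0r.
  by rewrite memN_msupp_eq0 //; apply: rdvd0.
have := hc m; rewrite mcoeffD mcoeffZ mcoeffX eqxx mulr1 memN_msupp_eq0 // addr0.
by case=> z ->; exists (z *: 'X_[m] + p'); rewrite scalerDr scalerA {1}ep.
Qed.

Lemma poly_divisible (R : comNzRingType) (c : R) (W : {poly R}) :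
  (forall l, rdvd c W`_l) -> exists W', W = c *: W'.
Proof.
elim/poly_ind: W => [_|p a IH hc]; first by exists 0; rewrite scaler0.
have [|p' ep] := IH.
  by move=> l; have := hc l.+1; rewrite coefD coefMX coefC addr0.
have := hc 0%N; rewrite coefD coefMX coefC add0r => -[z ->].
by exists (p' * 'X + z%:P); rewrite scalerDr scalerAl -ep -mul_polyC -[in RHS]polyCM.
Qed.

Lemma mpoly_scaleI n (R : idomainType) (c : R) : c != 0 ->
  injective ( *:%R c : {mpoly R[n]} -> {mpoly R[n]}).
Proof.
move=> nz_c x y e; apply/mpolyP => m; apply: (mulfI nz_c).
by rewrite -!mcoeffZ e.
Qed.

Lemma poly_scaleI (R : idomainType) (c : R) : c != 0 ->
  injective ( *:%R c : {poly R} -> {poly R}).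
Proof.
move=> nz_c x y e; apply/polyP => m; apply: (mulfI nz_c).
by rewrite -!coefZ e.
Qed.

Section PencilOfLines.
Variable R : idomainType.
Notation RX := {mpoly R[3]}.
Variables p0 p1 : R.

Definition pencil : RX := p1 *: 'X_0 - p0 *: 'X_1.

(** The plane is swept by the lines p1 X_0 = p0 X_1, with coordinate s = 'X on each of them.
    Setting X_2 = 1 loses nothing on homogeneous polynomials ([psi_homogenize]). *)
Definition psi : RX -> {poly R} :=
  mmap (@polyC R) (vec3 (p0%:P * 'X) (p1%:P * 'X) 1).

HB.instance Definition _ := GRing.RMorphism.on psi.

Lemma psiC c : psi c%:MP = c%:P. Proof. exact: mmapC. Qed.

Lemma psiZ c G : psi (c *: G) = c *: psi G.
Proof. by rewrite -mul_polyC [LHS]mmapZ. Qed.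

Lemma psiX0 : psi 'X_0 = p0 *: 'X.
Proof. by rewrite /psi mmapX mmap1U /vec3 /= mul_polyC. Qed.

Lemma psiX1 : psi 'X_1 = p1 *: 'X.
Proof. by rewrite /psi mmapX mmap1U /vec3 /= mul_polyC. Qed.

Lemma psiX2 : psi 'X_ord_max = 1.
Proof. by rewrite /psi mmapX mmap1U. Qed.

Lemma psi_pencil : psi pencil = 0.
Proof.
rewrite /pencil -!mul_mpolyC rmorphB !rmorphM /= !psiC psiX0 psiX1 -!mul_polyC; ring.
Qed.

Lemma psi_monomial m :
  psi 'X_[m] = (p0 ^+ m 0 * p1 ^+ m 1) *: 'X^(m 0 + m 1).
Proof.
rewrite /psi mmapX mmap1_vec3 expr1n mulr1 !exprMn -mul_polyC polyCM !polyC_exp exprD.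
ring.
Qed.

Lemma psi_coef (G : RX) l : (psi G)`_l =
  \sum_(m <- msupp G | (m 0%R + m 1%R == l)%N) G@_m * (p0 ^+ m 0 * p1 ^+ m 1).
Proof.
rewrite [G in LHS]mpolyE raddf_sum coef_sum [RHS]big_mkcond; apply: eq_bigr => m _ /=.
rewrite psiZ psi_monomial !coefZ coefXn eq_sym.
by case: eqP; rewrite ?mulr1 ?mulr0.
Qed.

Lemma psi_size j (G : RX) : G \is j.-homog -> (size (psi G) <= j.+1)%N.
Proof.
move=> /dhomogP hG; apply/leq_sizeP => l lt_jl; rewrite psi_coef big_seq_cond big1 //.
move=> m /andP[/hG /= hm /eqP e]; rewrite mdeg3 in hm.
by move: lt_jl; rewrite -e -hm; rewrite ltnNge leq_addr.
Qed.

Lemma psi_homogenize (S : comNzRingType) (f : {rmorphism R -> S}) x z j (G : RX) :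
  G \is j.-homog -> mmap f (vec3 (f p0 * x) (f p1 * x) z) G =
    \sum_(l < j.+1) f (psi G)`_l * (x ^+ l * z ^+ (j - l)).
Proof.
move=> /dhomogP hG; under eq_bigr => l _ do rewrite psi_coef raddf_sum mulr_suml.
rewrite (exchange_big_dep xpredT) //= /mmap; apply: eq_big_seq => m hm.
have := hG m hm; rewrite /= mdeg3 => em.
have lt_l : (m 0%R + m 1%R < j.+1)%N by rewrite -em ltnS leq_addr.
rewrite (big_pred1 (Ordinal lt_l)) => [|l] /=; last by rewrite -val_eqE eq_sym.
rewrite mmap1_vec3 -em addKn !rmorphM !rmorphXn !exprMn exprD; ring.
Qed.

Section Coprime.
Hypotheses (nz_p1 : p1 != 0) (p1_cancel : forall c, rdvd p1 (p0 * c) -> rdvd p1 c).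

(** Modulo p1 the pencil is - p0 X_1, and p0 is regular modulo p1. *)
Lemma pencil_cancel j G W : p1 ^+ j *: G = pencil * W -> rdvd pencil G.
Proof.
elim: j W => [|j IH] W e; first by exists W; rewrite -e expr0 scale1r.
have [W' eW] : exists W', W = p1 *: W'.
  apply: mpoly_divisible => m; apply: p1_cancel.
  exists (('X_0 * W - p1 ^+ j *: G)@_(m + U_(1))).
  rewrite -[RHS]mcoeffZ scalerBr scalerA -exprS e /pencil mulrBl -!scalerAl opprB addrC subrK.
  by rewrite [RHS]mcoeffZ (mulrC 'X_1) addmC mcoeffMX.
apply: (IH W'); apply: (mpoly_scaleI nz_p1).
by rewrite scalerA -exprS e eW scalerAr.
Qed.

(** Modulo the pencil, p1 X_0 equals p0 X_1, so that p1^j G becomes the homogenization of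
    [psi G]; the powers of p1 are then cancelled by [pencil_cancel]. *)
Lemma psi_kernel j G : G \is j.-homog -> psi G = 0 -> rdvd pencil G.
Proof.
move=> hG G0.
have cong i : rdvd pencil (p1%:MP * 'X_i -
    vec3 (p0%:MP * 'X_1) (p1%:MP * 'X_1) (p1%:MP * 'X_ord_max) i).
  case: (ord3P i) => ->; rewrite /vec3 /=.
  - by exists 1; rewrite mulr1 !mul_mpolyC.
  - by rewrite subrr; apply: rdvd0.
  - by rewrite subrr; apply: rdvd0.
have := rdvd_mmap (@mpolyC 3 R) G cong.
rewrite (mmap_homog _ _ _ hG) mmap_id (psi_homogenize _ _ _ hG) G0.
under eq_bigr => l _ do rewrite coef0 rmorph0 mul0r.
rewrite big1 // subr0 -rmorphXn /= mul_mpolyC => -[W e].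
exact: pencil_cancel e.
Qed.

End Coprime.

Section Line.
Variables w u2 : R.
Hypotheses (nz_u2 : u2 != 0) (u2_cancel : forall c, rdvd u2 (w * c) -> rdvd u2 c).

(** Its root is s = w / u2, the position of phi(t) on the line of the pencil attached to t. *)
Definition curve_line : {poly R} := w%:P - u2 *: 'X.

Lemma curve_line_cancel j g h : u2 ^+ j *: g = curve_line * h -> rdvd curve_line g.
Proof.
elim: j h => [|j IH] h e; first by exists h; rewrite -e expr0 scale1r.
have [h' eh] : exists h', h = u2 *: h'.
  apply: poly_divisible => l; apply: u2_cancel.
  exists (u2 ^+ j *: g + 'X * h)`_l.
  rewrite -[RHS]coefZ scalerDr scalerA -exprS e /curve_line mulrBl -scalerAl subrK.
  by rewrite coefCM.
apply: (IH h'); apply: (poly_scaleI nz_u2).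
by rewrite scalerA -exprS e eh scalerAr.
Qed.

Lemma curve_line_size g h j : g = curve_line * h -> (size g <= j.+1)%N -> (size h <= j)%N.
Proof.
move=> ->; have [->|nz_h] := eqVneq h 0; first by rewrite size_poly0.
have sL : size curve_line = 2.
  rewrite /curve_line addrC size_polyDl size_polyN size_scale ?size_polyX //.
  by rewrite (leq_ltn_trans (size_polyC_leq1 _)).
by rewrite size_mul // -?size_poly_eq0 sL.
Qed.

(** Modulo w - u2 s, the polynomial u2^j psi(G) becomes G(u), by homogeneity. *)
Lemma curve_line_dvd (u : 'I_3 -> R) j G : u =1 vec3 (p0 * w) (p1 * w) u2 ->
  G \is j.-homog -> G.@[u] = 0 ->
  exists2 h, psi G = curve_line * h & (size h <= j)%N.
Proof.
move=> eu hG G0; pose g := psi G.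
have hom0 : \sum_(l < j.+1) g`_l * (w ^+ l * u2 ^+ (j - l)) = 0.
  rewrite -(psi_homogenize idfun w u2 hG) -[RHS]G0 /meval; exact: eq_mmap.
have [h eh] : rdvd curve_line (u2 ^+ j *: g).
  have -> : u2 ^+ j *: g = \sum_(l < j.+1) (g`_l * u2 ^+ (j - l))%:P *
      ((u2 *: 'X) ^+ l - w%:P ^+ l).
    have -> : \sum_(l < j.+1) (g`_l * u2 ^+ (j - l))%:P * ((u2 *: 'X) ^+ l - w%:P ^+ l)
        = \sum_(l < j.+1) (g`_l * u2 ^+ (j - l))%:P * (u2 *: 'X) ^+ l
          - (\sum_(l < j.+1) g`_l * (w ^+ l * u2 ^+ (j - l)))%:P.
      rewrite rmorph_sum -sumrB; apply: eq_bigr => l _ /=.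
      by rewrite mulrBr !polyCM !polyC_exp; congr (_ - _); ring.
    rewrite hom0 subr0; have sg := psi_size hG.
    apply/polyP => i; rewrite coefZ [RHS]coef_sum.
    have [lt_ji|le_ij] := leqP j.+1 i.
      have -> : g`_i = 0 by apply: nth_default; apply: leq_trans sg lt_ji.
      rewrite mulr0 big1 // => l _.
      rewrite exprZn coefCM coefZ coefXn; case: eqP => [e|_]; last by rewrite !mulr0.
      by have := ltn_ord l; rewrite -e ltnNge lt_ji.
    rewrite (bigD1 (Ordinal le_ij)) //= big1 => [|l ne_l].
      rewrite addr0 exprZn coefCM coefZ coefXn eqxx mulr1 -mulrA -exprD subnK //.
      by rewrite mulrC.
    rewrite exprZn coefCM coefZ coefXn; case: eqP => [e|_]; last by rewrite !mulr0.
    by case/eqP: ne_l; apply: val_inj.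
  elim/big_rec: _ => [|l y _ hy]; first exact: rdvd0.
  apply: rdvdD hy; apply: rdvdMl; apply: rdvd_subX.
  by exists (-1); rewrite /curve_line; ring.
have [h' eh'] := curve_line_cancel eh.
by exists h' => //; apply: curve_line_size eh' (psi_size hG).
Qed.

End Line.
End PencilOfLines.

(** * Gradings *)

(** An N-graded domain, presented by its homogeneous elements and its projections; in the
    application it is K[T_0, T_1]. *)
Record grading (R : idomainType) := Grading {
  ghom : nat -> R -> Prop;
  gcomp : nat -> {additive R -> R};
  gsize : R -> nat;
  gcomp_hom : forall i x, ghom i (gcomp i x);
  gcomp_id : forall i x, ghom i x -> gcomp i x = x;
  gcomp_neq : forall i j x, i <> j -> ghom i x -> gcomp j x = 0;
  gcomp_sum : forall x N, (gsize x <= N)%N -> x = \sum_(i < N) gcomp i x;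
  gcompM : forall d k a x, ghom d a -> gcomp (d + k) (a * x) = a * gcomp k x;
  gcompM_small : forall d k a x, ghom d a -> (k < d)%N -> gcomp k (a * x) = 0;
  ghom1 : ghom 0 1
}.

Lemma mcoeff_pihomog n (R : nzRingType) j (G : {mpoly R[n]}) m :
  (pihomog mdeg j G)@_m = if mdeg m == j then G@_m else 0.
Proof.
case: eqP => [<-|ne_j]; last by rewrite (dhomog_nemf_coeff (pihomogP _ _ _)) //; apply/eqP.
elim/mpolyind: G => [|c x p _ _ IH]; first by rewrite pihomog0.
rewrite pihomogD !mcoeffD IH linearZ /= !mcoeffZ pihomogX; congr (_ * _ + _).
by case: eqP => // ne; rewrite mcoeff0 mcoeffX; case: eqP => // e; rewrite e in ne.
Qed.

Section GradedRing.
Variables (R : idomainType) (gr : grading R).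
Notation hom := (ghom gr).
Notation comp := (gcomp gr).

Lemma ghom0 i : hom i 0.
Proof. by have := gcomp_hom gr i 0; rewrite raddf0. Qed.

Lemma ghomD i x y : hom i x -> hom i y -> hom i (x + y).
Proof.
move=> hx hy; have := gcomp_hom gr i (x + y).
by rewrite raddfD /= (gcomp_id hx) (gcomp_id hy).
Qed.

Lemma ghomN i x : hom i x -> hom i (- x).
Proof. by move=> hx; have := gcomp_hom gr i (- x); rewrite raddfN /= (gcomp_id hx). Qed.

Lemma ghomM i j x y : hom i x -> hom j y -> hom (i + j) (x * y).
Proof.
move=> hx hy; have := gcomp_hom gr (i + j) (x * y).
by rewrite (gcompM _ _ hx) (gcomp_id hy).
Qed.

Lemma ghomX i x k : hom i x -> hom (k * i) (x ^+ k).
Proof.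
move=> hx; elim: k => [|k IH]; first by rewrite expr0; apply: ghom1.
by rewrite exprS mulSn; apply: ghomM.
Qed.

Lemma ghom_sum i (I : Type) (r : seq I) (P : pred I) (F : I -> R) :
  (forall k, P k -> hom i (F k)) -> hom i (\sum_(k <- r | P k) F k).
Proof. by move=> hF; elim/big_rec: _ => [|k y Pk hy]; [exact: ghom0 | apply: ghomD; auto]. Qed.

Lemma ghom_quotient d e a x : a != 0 -> hom d a -> hom (d + e) (a * x) -> hom e x.
Proof.
move=> nz_a ha /gcomp_id; rewrite (gcompM _ _ ha) => /(mulfI nz_a) <-.
exact: gcomp_hom.
Qed.

Lemma ghom_monomial n (v : 'I_n -> R) d (m : 'X_{1..n}) :
  (forall i, hom d (v i)) -> hom (mdeg m * d) (\prod_i v i ^+ m i).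
Proof.
move=> hv; rewrite mdegE big_distrl /=.
elim/big_rec2: _ => [|i x y _ hy]; first exact: ghom1.
by apply: ghomM => //; apply: ghomX.
Qed.

Section Bigraded.
Variable n : nat.
Notation RX := {mpoly R[n]}.
Implicit Types G : RX.

Definition bihom i j G := G \is j.-homog /\ forall m, hom i G@_m.

Definition bicomp i j G : RX := map_mpoly (comp i) (pihomog mdeg j G).

Lemma bicomp_coef i j G m :
  (bicomp i j G)@_m = if mdeg m == j then comp i G@_m else 0.
Proof.
by rewrite /bicomp mcoeff_map_mpoly mcoeff_pihomog; case: eqP => //; rewrite raddf0.
Qed.

Lemma bicomp_bihom i j G : bihom i j (bicomp i j G).
Proof.
split=> [|m]; last by rewrite bicomp_coef; case: eqP => _; [apply: gcomp_hom | apply: ghom0].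
apply/dhomogP => m; rewrite mcoeff_msupp bicomp_coef.
by case: (mdeg m =P j) => // _; rewrite eqxx.
Qed.

Lemma bicomp_id i j G : bihom i j G -> bicomp i j G = G.
Proof.
move=> [hG hc]; apply/mpolyP => m; rewrite bicomp_coef gcomp_id //.
by case: eqP => // /eqP ne; rewrite (dhomog_nemf_coeff hG).
Qed.

Lemma bicomp_sum G : exists N M, G = \sum_(j < N) \sum_(i < M) bicomp i j G.
Proof.
exists (msize G), (\max_(m <- msupp G) gsize gr G@_m)%N; apply/mpolyP => m.
rewrite raddf_sum /=; under eq_bigr => j _.
  rewrite raddf_sum /=; under eq_bigr => i _ do rewrite bicomp_coef; over.
have [hm|hm] := boolP (m \in msupp G); last first.
  rewrite memN_msupp_eq0 // big1 // => j _; rewrite big1 // => i _.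
  by rewrite raddf0 if_same.
rewrite (bigD1 (Ordinal (msize_mdeg_lt hm))) //= [X in _ + X]big1 => [|j ne_j].
  rewrite addr0 eqxx; apply: gcomp_sum; exact: (leq_bigmax_seq (F := fun m => gsize gr G@_m)).
rewrite big1 // => i _; case: eqP => // e.
by case/eqP: ne_j; apply: val_inj.
Qed.

Lemma bicompD i j G H : bicomp i j (G + H) = bicomp i j G + bicomp i j H.
Proof. by rewrite /bicomp pihomogD raddfD. Qed.

Lemma map_comp_monomial i x m :
  map_mpoly (comp i) (x *: 'X_[m]) = comp i x *: 'X_[m] :> RX.
Proof.
apply/mpolyP => z; rewrite mcoeff_map_mpoly /= !mcoeffZ mcoeffX.
by case: eqP => _; rewrite ?mulr1 ?mulr0 ?raddf0.
Qed.

Lemma map_compM a b l (s c : RX) : bihom a b s ->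
  map_mpoly (comp (a + l)) (s * c) = s * map_mpoly (comp l) c.
Proof.
move=> [_ hs]; elim/mpolyind: c => [|x m p _ _ IH]; first by rewrite mulr0 !raddf0 mulr0.
rewrite mulrDr !raddfD /= IH mulrDr; congr (_ + _).
apply/mpolyP => y; rewrite mcoeff_map_mpoly /=.
rewrite map_comp_monomial -!scalerAr !mcoeffZ ![_ * (s * _)@__]mulrC gcompM //.
rewrite mcoeffM; apply: ghom_sum => k _; rewrite mcoeffX.
by case: eqP => _; rewrite ?mulr1 ?mulr0 //; apply: ghom0.
Qed.

Lemma map_compM_small a b l (s c : RX) : bihom a b s -> (l < a)%N ->
  map_mpoly (comp l) (s * c) = 0.
Proof.
move=> [_ hs] lt_la; apply/mpolyP => y; rewrite mcoeff_map_mpoly /= mcoeff0.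
by rewrite mcoeffM raddf_sum big1 // => k _; apply: gcompM_small (hs _) lt_la.
Qed.

(** A product by a bihomogeneous [s] has as components the products by [s] of the components
    of the other factor, with degrees shifted. *)
Lemma bicompM i j a b (c s : RX) : bihom a b s ->
  exists2 c', bicomp i j (c * s) = c' * s & (i < a)%N || (j < b)%N -> c' = 0.
Proof.
move=> hs; have [lt_ia|le_ai] := ltnP i a; last have [lt_jb|le_bj] := ltnP j b.
- exists 0; rewrite // mul0r /bicomp -[LHS]/(map_mpoly _ _) mulrC.
  have [lt_jb|le_bj] := ltnP j b.
    by rewrite (pihomogM_small _ hs.1 lt_jb) raddf0.
  by rewrite -(subnKC le_bj) (pihomogM _ _ hs.1) (map_compM_small _ hs).
- by exists 0; rewrite // mul0r /bicomp mulrC (pihomogM_small _ hs.1 lt_jb) raddf0.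
exists (bicomp (i - a) (j - b) c) => //.
rewrite /bicomp [c * s]mulrC -{1}(subnKC le_bj) (pihomogM _ _ hs.1).
by rewrite -{1}(subnKC le_ai) (map_compM _ _ hs) mulrC.
Qed.

Section Rees.
Variables (u : 'I_n -> R) (d : nat).
Hypothesis hu : forall i, hom d (u i).

(** The substitution X_i := u_i Z, over any coefficient ring. *)
Definition rees (G : RX) : {poly R} := mmap (@polyC R) (fun i => u i *: 'X) G.

Lemma rees_homog j G : G \is j.-homog -> rees G = G.@[u] *: 'X^j.
Proof.
move=> hG; rewrite /rees (@eq_mmap _ _ _ _ _ (fun i => 'X * (u i)%:P)).
  rewrite (mmap_homog _ _ _ hG) mulrC -mul_polyC; congr (_ * _).
  by rewrite -(mmap_comp idfun polyC).
by move=> i; rewrite mulrC mul_polyC.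
Qed.

Lemma rees_coef j G : (rees G)`_j = (pihomog mdeg j G).@[u].
Proof.
rewrite {1}(pihomog_sum_all G) /rees raddf_sum coef_sum /=.
have [lt_j|le_j] := ltnP j (msize G).
  rewrite (bigD1 (Ordinal lt_j)) //= big1 => [|k ne_k].
    by rewrite addr0 -/(rees _) (rees_homog (pihomogP _ _ _)) coefZ coefXn eqxx mulr1.
  rewrite -/(rees _) (rees_homog (pihomogP _ _ _)) coefZ coefXn.
  by case: eqP => [e|]; rewrite ?mulr0 //; case/eqP: ne_k; apply: val_inj.
rewrite big1 => [|k _].
  rewrite (_ : pihomog _ _ _ = 0) ?meval0 //; apply/mpolyP => m.
  rewrite mcoeff_pihomog mcoeff0; case: eqP => // em; apply: memN_msupp_eq0.
  by apply: msize_mdeg_ge; rewrite em.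
rewrite -/(rees _) (rees_homog (pihomogP _ _ _)) coefZ coefXn.
by case: eqP => [e|]; rewrite ?mulr0 //; have := ltn_ord k; rewrite -e ltnNge le_j.
Qed.

Lemma meval_bicomp i j G : (bicomp i j G).@[u] = comp (j * d + i) (pihomog mdeg j G).@[u].
Proof.
rewrite /bicomp; elim/mpolyind: G => [|c m p _ _ IH]; first by rewrite !raddf0.
rewrite pihomogD !raddfD /= IH; congr (_ + _).
rewrite linearZ /= pihomogX; case: eqP => [<-|_]; last by rewrite scaler0 !raddf0.
rewrite map_comp_monomial !mevalZ mevalX ![_ * \prod_k _]mulrC gcompM //.
exact: ghom_monomial.
Qed.

Lemma rees_kernel_bicomp i j G : rees G = 0 -> (bicomp i j G).@[u] = 0.
Proof. by move=> G0; rewrite meval_bicomp -rees_coef G0 coef0 raddf0. Qed.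

End Rees.
End Bigraded.
End GradedRing.

Section TotalDegree.
Variables (n : nat) (R : idomainType).

Lemma total_degree_neq i j (x : {mpoly R[n]}) :
  i <> j -> x \is i.-homog -> pihomog mdeg j x = 0.
Proof. by move=> /eqP ne hx; apply: pihomog_ne0 ne hx. Qed.

Definition total_degree : grading {mpoly R[n]} := {|
  ghom := fun i (x : {mpoly R[n]}) => x \is i.-homog;
  gcomp := fun i => pihomog mdeg i;
  gsize := fun x => msize x;
  gcomp_hom := fun i x => pihomogP mdeg i x;
  gcomp_id := fun i x => @pihomog_dE n R mdeg i x;
  gcomp_neq := total_degree_neq;
  gcomp_sum := fun x N => @pihomog_partitionE n R mdeg N x;
  gcompM := fun d k a x => @pihomogM n R d a k x;
  gcompM_small := fun d k a x => @pihomogM_small n R d a k x;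
  ghom1 := dhomog1 R mdeg |}.
End TotalDegree.

(** * Generation and irredundancy over a graded domain *)

Section Ideals.
Variable A : comNzRingType.
Implicit Types (s : seq A) (f g : A).

Lemma in_ideal0 s : in_ideal_gen s 0.
Proof. by exists (fun=> 0); rewrite big1 // => i _; rewrite mul0r. Qed.

Lemma in_idealD s f g : in_ideal_gen s f -> in_ideal_gen s g -> in_ideal_gen s (f + g).
Proof.
move=> [a ->] [b ->]; exists (fun i => a i + b i).
by rewrite -big_split; apply: eq_bigr => i _; rewrite mulrDl.
Qed.

Lemma in_idealM s c f : in_ideal_gen s f -> in_ideal_gen s (c * f).
Proof.
move=> [a ->]; exists (fun i => c * a i).
by rewrite big_distrr; apply: eq_bigr => i _; rewrite /= mulrA.
Qed.

Lemma in_ideal_sum s (I : Type) (r : seq I) (P : pred I) (F : I -> A) :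
  (forall i, P i -> in_ideal_gen s (F i)) -> in_ideal_gen s (\sum_(i <- r | P i) F i).
Proof.
by move=> hF; elim/big_rec: _ => [|i x Pi]; [exact: in_ideal0 | apply: in_idealD; exact: hF].
Qed.

Lemma mem_in_ideal s f : f \in s -> in_ideal_gen s f.
Proof.
move=> fs; exists (fun i => (i == index f s)%:R).
have lt_f : (index f s < size s)%N by rewrite index_mem.
rewrite (bigD1 (Ordinal lt_f)) //= eqxx mul1r nth_index // big1 ?addr0 // => i ne_i.
case: eqP => [e|_]; last by rewrite mul0r.
by case/eqP: ne_i; apply: val_inj.
Qed.

Lemma rdvd_in_ideal s f g : f \in s -> rdvd f g -> in_ideal_gen s g.
Proof. by move=> fs [z ->]; rewrite mulrC; apply: in_idealM; apply: mem_in_ideal. Qed.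

(** Indexed by positions, so that a repeated element counts as redundant. *)
Definition irredundant s := forall l, (l < size s)%N ->
  ~ exists c : nat -> A, s`_l = \sum_(m < size s | (m : nat) != l) c m * s`_m.

Lemma irredundant_uniq s : irredundant s -> uniq s.
Proof.
move=> irr; apply/(uniqP 0) => i j lt_i lt_j eij; apply/eqP/negPn/negP => ne_ij.
apply: (irr i lt_i); exists (fun m => (m == j)%:R).
rewrite (bigD1 (Ordinal lt_j)) /=; last by rewrite eq_sym.
rewrite eqxx mul1r eij big1 ?addr0 // => m /andP[_ ne_m].
case: eqP => [e|_]; last by rewrite mul0r.
by case/eqP: ne_m; apply: val_inj.
Qed.

Lemma irredundant_minimal (I : A -> Prop) s : irredundant s -> generates I s ->
  minimal_generators I s.
Proof.
move=> irr gen; split=> // [|s' sub gen' x xs]; first exact: irredundant_uniq.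
apply/negPn/negP => xs'; have lt_x : (index x s < size s)%N by rewrite index_mem.
apply: (irr _ lt_x); rewrite nth_index //.
have [c ex] : in_ideal_gen s' x by apply/gen'/gen/mem_in_ideal.
exists (fun m => \sum_(i < size s' | index (s'`_i)%R s == m) c i).
have in_s (i : 'I_(size s')) : s'`_i \in s by apply/sub/mem_nth.
have lt_i (i : 'I_(size s')) : (index (s'`_i)%R s < size s)%N by rewrite index_mem.
rewrite [LHS]ex; under [RHS]eq_bigr => m _ do rewrite mulr_suml.
rewrite (exchange_big_dep xpredT) //=; apply: eq_bigr => i _.
rewrite (big_pred1 (Ordinal (lt_i i))) /= ?nth_index // => m.
apply/andP/eqP => [[_ /eqP e]|->]; first by apply: val_inj; rewrite /= e.
split=> //=; apply/eqP => /(congr1 (nth 0 s)); rewrite !nth_index // => e.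
by rewrite -e mem_nth in xs'.
Qed.

End Ideals.

Section MovingCurves.
Variables (R : idomainType) (gr : grading R).
Notation hom := (ghom gr).
Notation RX := {mpoly R[3]}.

Lemma bihomM i j a b (G H : RX) : bihom gr i j G -> bihom gr a b H ->
  bihom gr (i + a) (j + b) (G * H).
Proof.
move=> [hG cG] [hH cH]; split=> [|m]; first exact: dhomogM.
by rewrite mcoeffM; apply: ghom_sum => x _; apply: ghomM.
Qed.

Lemma bihomD i j (G H : RX) : bihom gr i j G -> bihom gr i j H -> bihom gr i j (G + H).
Proof.
move=> [hG cG] [hH cH]; split=> [|m]; first exact: rpredD.
by rewrite mcoeffD; apply: ghomD.
Qed.

Lemma bihomN i j (G : RX) : bihom gr i j G -> bihom gr i j (- G).
Proof.
move=> [hG cG]; split=> [|m]; first by rewrite rpredN.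
by rewrite mcoeffN; apply: ghomN.
Qed.

Lemma bihomZ i j e c (G : RX) : hom e c -> bihom gr i j G -> bihom gr (e + i) j (c *: G).
Proof.
move=> hc [hG cG]; split=> [|m]; first by rewrite rpredZ.
by rewrite mcoeffZ; apply: ghomM.
Qed.

Lemma bihomX i : bihom gr 0 1 ('X_i : RX).
Proof.
split=> [|m]; first by rewrite dhomogX /= mdeg1.
by rewrite mcoeffX; case: eqP => _; [apply: ghom1 | apply: ghom0].
Qed.

Lemma bihom_quotient i j e c (G : RX) : c != 0 -> hom e c ->
  bihom gr (e + i) j (c *: G) -> bihom gr i j G.
Proof.
move=> nz_c hc [hG cG]; split=> [|m]; last first.
  by apply: (ghom_quotient nz_c hc); rewrite -mcoeffZ.
apply/dhomogP => m; rewrite mcoeff_msupp => nz_m.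
by apply: (dhomogP _ _ _ hG m); rewrite mcoeff_msupp mcoeffZ mulf_neq0.
Qed.

Lemma psi_coef_hom p0 p1 i j (G : RX) l : hom 2 p0 -> hom 2 p1 -> bihom gr i j G ->
  hom (i + 2 * l) (psi p0 p1 G)`_l.
Proof.
move=> h0 h1 [_ hG]; rewrite psi_coef; apply: ghom_sum => m /eqP <-.
apply: ghomM => //; rewrite mulnC mulnDl; apply: ghomM; exact: ghomX.
Qed.

(** Project the relation to the bidegree of the generator in question. *)
Lemma bidegree_combination (s : seq RX) (dT dX : nat -> nat) l :
  (forall m, (m < size s)%N -> bihom gr (dT m) (dX m) s`_m) -> (l < size s)%N ->
  (exists c : nat -> RX, s`_l = \sum_(m < size s | (m : nat) != l) c m * s`_m) ->
  exists c : 'I_(size s) -> RX, s`_l =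
    \sum_(m < size s | [&& (m : nat) != l, dT m <= dT l & dX m <= dX l]%N) c m * s`_m.
Proof.
move=> hs lt_l [c e].
have ex (m : 'I_(size s)) : exists c', bicomp gr (dT l) (dX l) (c m * s`_m) = c' * s`_m
    /\ ((dT l < dT m)%N || (dX l < dX m)%N -> c' = 0).
  by have [c' e1 e2] := bicompM (dT l) (dX l) (c m) (hs m (ltn_ord m)); exists c'.
have [c' hc'] := fin_all_exists ex; exists c'.
rewrite -(bicomp_id (hs l lt_l)) e.
transitivity (\sum_(m < size s | (m : nat) != l) c' m * s`_m).
  have bicompS (P : pred 'I_(size s)) (F : 'I_(size s) -> RX) :
      bicomp gr (dT l) (dX l) (\sum_(m | P m) F m)
      = \sum_(m | P m) bicomp gr (dT l) (dX l) (F m).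
    apply: (big_morph _ (bicompD gr (dT l) (dX l))).
    by rewrite /bicomp pihomog0 raddf0.
  by rewrite bicompS; apply: eq_bigr => m _; case: (hc' m).
rewrite (bigID (fun m : 'I_(size s) => (dT m <= dT l) && (dX m <= dX l))%N) /=.
rewrite [X in _ + X]big1 ?addr0 // => m /andP[_].
by rewrite negb_and -!ltnNge; case: (hc' m) => _ h /h ->; rewrite mul0r.
Qed.

Variables (k : nat) (u : 'I_3 -> R) (p0 p1 w u2 : R).
Hypotheses (hk : (3 <= k)%N) (hp0 : hom 2 p0) (hp1 : hom 2 p1).
Hypotheses (eu : u =1 vec3 (p0 * w) (p1 * w) u2).

Notation P := (pencil p0 p1).
Notation psi := (psi p0 p1).

Variables (F : nat -> RX).
Hypotheses (hQ : bihom gr (2 * k - 2) 1 (F 1%N)) (Q0 : (F 1%N).@[u] = 0).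
Hypotheses (hF : forall j, (2 <= j <= k - 1)%N -> exists G0 G1,
  [/\ bihom gr (2 * (k - j + 1) - 2) (j - 1) G0, bihom gr (2 * (k - j + 1) - 2) (j - 1) G1,
      F (j - 1)%N = p0 *: G0 + p1 *: G1 & F j = 'X_0 * G0 + 'X_1 * G1]).

Lemma pencil_bihom : bihom gr 2 1 P.
Proof.
by apply: bihomD; [|apply: bihomN];
   [apply: (bihomZ hp1 (bihomX 0)) | apply: (bihomZ hp0 (bihomX 1))].
Qed.

Lemma pencil_meval : P.@[u] = 0.
Proof.
rewrite /pencil mevalB !mevalZ !mevalXU !eu /vec3 /=; ring.
Qed.

(** The operator D_T turns p_i into X_i, and [psi] turns X_i back into p_i with a factor s. *)
Lemma moving_curve_spec j : (1 <= j <= k - 1)%N ->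
  [/\ bihom gr (2 * (k - j)) j (F j), (F j).@[u] = 0 & psi (F j) = 'X^(j - 1) * psi (F 1%N)].
Proof.
elim: j => // -[|j] IH hj.
  rewrite subnn expr0 mul1r; split=> //; by have -> : (2 * (k - 1) = 2 * k - 2)%N by lia.
have [|hFj Fj0 Fjpsi] := IH; first by lia.
have [|G0 [G1 [hG0 hG1 e1 e2]]] := hF (j := j.+2); first by lia.
rewrite (_ : j.+2 - 1 = j.+1)%N in e1 hG0 hG1; last by lia.
rewrite (_ : 2 * (k - j.+2 + 1) - 2 = 2 * (k - j.+2))%N in hG0 hG1; last by lia.
split; rewrite e2.
- by apply: bihomD; rewrite -(add0n (2 * _)%N) -(add1n j.+1); apply: bihomM => //; apply: bihomX.
- move: Fj0; rewrite e1 !mevalD !mevalZ !mevalM !mevalXU !eu /vec3 /= => e.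
  by rewrite -[RHS](mulr0 w) -e; ring.
rewrite (_ : j.+2 - 1 = j.+1)%N; last by lia.
have := Fjpsi; rewrite e1 !rmorphD !rmorphM /= psiX0 psiX1 !psiZ.
rewrite (_ : j.+1 - 1 = j)%N ?exprS -?mulrA; last by lia.
by move=> <-; rewrite -!mul_polyC; ring.
Qed.

Lemma last_moving_conic_spec : [/\ bihom gr 2 (k - 1) (F (k - 1)%N), (F (k - 1)%N).@[u] = 0
  & psi (F (k - 1)%N) = 'X^(k - 2) * psi (F 1%N)].
Proof.
have [|h1 h2 h3] := @moving_curve_spec (k - 1); first by lia.
rewrite (_ : 2 * (k - (k - 1)) = 2)%N in h1; last by lia.
by split=> //; rewrite h3; congr ('X^_ * _); lia.
Qed.

(** The factor [T] divides [psi A], and [psi] kills P. *)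
Lemma sylvester_form_spec T A M l S : hom 1 T -> T != 0 -> bihom gr 0 1 A ->
  psi A = (T * l) *: 'X -> bihom gr 0 (k - 1) M -> M * P - A * F (k - 1)%N = T *: S ->
  [/\ bihom gr 1 k S, S.@[u] = 0 & psi S = - (l *: ('X^(k - 1) * psi (F 1%N)))].
Proof.
move=> hT nz_T hA Apsi hM eS; have [hL L0 Lpsi] := last_moving_conic_spec.
split.
- apply: (bihom_quotient nz_T hT); rewrite -eS; apply: bihomD; last apply: bihomN.
    by have := bihomM hM pencil_bihom; rewrite subnK //; lia.
  by have := bihomM hA hL; rewrite subnKC //; lia.
- apply: (mulfI nz_T); rewrite -mevalZ -eS mevalB !mevalM pencil_meval L0; ring.
apply: (poly_scaleI nz_T); rewrite -psiZ -eS rmorphB !rmorphM /= psi_pencil Apsi Lpsi.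
rewrite (_ : k - 1 = (k - 2).+1)%N ?exprS; last by lia.
by rewrite -!mul_polyC polyCM; ring.
Qed.

Variables (T0 T1 l0 l1 : R) (F01 F11 A0 A1 M0 M1 E : RX).
Hypotheses (hT0 : hom 1 T0) (hT1 : hom 1 T1) (nz_T0 : T0 != 0) (nz_T1 : T1 != 0).
Hypotheses (hA0 : bihom gr 0 1 A0) (hA1 : bihom gr 0 1 A1).
Hypotheses (A0psi : psi A0 = (T1 * l0) *: 'X) (A1psi : psi A1 = (T0 * l1) *: 'X).
Hypotheses (hM0 : bihom gr 0 (k - 1) M0) (hM1 : bihom gr 0 (k - 1) M1).
Hypotheses (eF01 : M0 * P - A0 * F (k - 1)%N = T1 *: F01).
Hypotheses (eF11 : M1 * P - A1 * F (k - 1)%N = T0 *: F11).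

(** Membership in (l0, l1) (p0, p1)^m. *)
Fixpoint power_comb m (f : R) : Prop :=
  if m is m'.+1 then exists f0 f1, [/\ power_comb m' f0, power_comb m' f1
                                    & f = f0 * p0 + f1 * p1]
  else exists a b, f = a * l0 + b * l1.

(** Replacing each p_i by X_i lifts an element of (p0, p1)^m along [psi] at the cost of s^m. *)
Lemma power_comb_lift m f : power_comb m f -> exists B0 B1 : RX,
  [/\ B0 \is m.-homog, B1 \is m.-homog
    & l0 *: psi B0 + l1 *: psi B1 = f *: 'X^m].
Proof.
elim: m f => [|m IH] f.
  move=> [a [b ->]]; exists a%:MP, b%:MP.
  have hC c : (c%:MP : RX) \is 0.-homog by rewrite -[c%:MP]mulr1 mul_mpolyC rpredZ // dhomog1.
  by split; rewrite ?hC // !psiC expr0 alg_polyC -!mul_polyC polyCD !polyCM; ring.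
move=> [f0 [f1 [/IH[B00 [B01 [h00 h01 e0]]] /IH[B10 [B11 [h10 h11 e1]]] ->]]].
exists ('X_0 * B00 + 'X_1 * B10), ('X_0 * B01 + 'X_1 * B11).
have hX (i : 'I_3) : ('X_i : RX) \is 1.-homog by rewrite dhomogX /= mdeg1.
split; try by rewrite -[m.+1]add1n; apply: rpredD; apply: dhomogM.
rewrite !rmorphD !rmorphM /= psiX0 psiX1.
transitivity ('X * (p0 *: (l0 *: psi B00 + l1 *: psi B01)
                  + p1 *: (l0 *: psi B10 + l1 *: psi B11))).
  by rewrite -!mul_polyC; ring.
by rewrite e0 e1 exprS -!mul_polyC polyCD !polyCM; ring.
Qed.

Lemma sylvester_forms_spec : [/\ bihom gr 1 k F01, F01.@[u] = 0
    & psi F01 = - (l0 *: ('X^(k - 1) * psi (F 1%N)))] /\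
  [/\ bihom gr 1 k F11, F11.@[u] = 0
    & psi F11 = - (l1 *: ('X^(k - 1) * psi (F 1%N)))].
Proof.
split; first exact: sylvester_form_spec eF01.
exact: sylvester_form_spec eF11.
Qed.

Lemma dhomogXnM n (A : comNzRingType) (i : 'I_n) e b j (H : {mpoly A[n]}) :
  H \is b.-homog -> (e + b = j)%N -> 'X_i ^+ e * H \is j.-homog.
Proof.
by move=> hH <-; apply: dhomogM hH; rewrite mpolyXn dhomogX /= mdegMn mdeg1 mul1n.
Qed.

Definition gens : seq RX := [:: E; F01; F11; P] ++ [seq F j | j <- iota 1 (k - 1)].

Lemma gens_size : size gens = (k + 3)%N.
Proof. by clear -hk; rewrite size_cat size_map size_iota /=; lia. Qed.

Lemma gens_nth q : (q < k - 1)%N -> gens`_(4 + q) = F q.+1.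
Proof.
move=> lt_q; rewrite nth_cat /= addKn (nth_map 0%N) ?size_iota // nth_iota //.
Qed.

Lemma family_in_gens j : (1 <= j <= k - 1)%N -> F j \in gens.
Proof.
by move=> hj; rewrite mem_cat; apply/orP; right; apply: map_f; rewrite mem_iota; lia.
Qed.

Hypotheses (hw : hom (2 * k - 2) w) (hu2 : hom (2 * k) u2).
Hypotheses (nz_p1 : p1 != 0) (p1_cancel : forall c, rdvd p1 (p0 * c) -> rdvd p1 c).
Hypotheses (nz_u2 : u2 != 0) (u2_cancel : forall c, rdvd u2 (w * c) -> rdvd u2 c).
Hypotheses (nz_w : w != 0) (Qpsi : psi (F 1%N) != 0).
Hypotheses (hom0_unit : forall c, hom 0 c -> c != 0 -> exists c', c * c' = 1).
Hypotheses (l_comb : forall m i f, hom (i.+1 + 2 * m) f -> power_comb m f).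

(** The constant coefficient of the image of Q has the degree of [w], which leaves
    a quotient of degree 0. *)
Lemma psi_Q_line : exists c, psi (F 1%N) = c *: curve_line w u2
  /\ exists c', c * c' = 1.
Proof.
have [h eh sh] := curve_line_dvd nz_u2 u2_cancel eu hQ.1 Q0.
have eC := size1_polyC sh; set c := h`_0 in eC.
exists c; split; first by rewrite eh eC mulrC mul_polyC.
apply: hom0_unit; last first.
  by apply: contraNneq Qpsi => c0; rewrite eh eC c0 mulr0.
apply: (ghom_quotient nz_w hw).
have := psi_coef_hom 0 hp0 hp1 hQ; rewrite eh eC mulrC mul_polyC coefZ.
by rewrite /curve_line coefB coefC coefZ coefX /= mulr0 subr0 mulrC muln0.
Qed.

(** Write psi(G) = h psi(Q) and lift the terms of h one by one: s^l psi(Q) is the image of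
    a moving curve of the family if l < k - 1, and for l >= k - 1 the coefficient of s^l has
    enough degree to be a combination of l0 and l1 with coefficients in (p0, p1)^(l - k + 1).
    The difference between G and the lift is a multiple of P. *)
Lemma positive_T_degree i j G : bihom gr i.+1 j G -> G.@[u] = 0 -> in_ideal_gen gens G.
Proof.
move=> hG G0.
have [c [eQ [c' cc']]] := psi_Q_line.
have [h eh sh] := curve_line_dvd nz_u2 u2_cancel eu hG.1 G0.
(* Stating the degree of h_l as that of w h_l covers the l for which it would be negative. *)
have hwh l : hom (i.+1 + 2 * l) (w * h`_l).
  elim: l => [|l IH].
    have := psi_coef_hom 0 hp0 hp1 hG; rewrite eh /curve_line mulrBl coefB coefCM.
    by rewrite -scalerAl coefZ coefXM /= mulr0 subr0.
  have hu2h : hom (i.+1 + 2 * l.+1) (u2 * h`_l).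
    apply: (ghom_quotient nz_w hw); rewrite mulrCA.
    by have := ghomM hu2 IH; congr (ghom gr _ _); lia.
  have := ghomD (psi_coef_hom l.+1 hp0 hp1 hG) hu2h.
  rewrite eh /curve_line mulrBl coefB coefCM -scalerAl coefZ.
  by rewrite coefXM /= subrK.
(* The image of Q is c (w - u2 s), whence the factor c' = 1 / c. *)
have term (l : 'I_j) : exists t, [/\ t \is j.-homog, in_ideal_gen gens t
    & psi t = (c' * h`_l) *: ('X^l * psi (F 1%N))].
  have lt_lj := ltn_ord l.
  have [lt_lk|le_kl] := ltnP l (k - 1).
    have [|hF1 _ Fpsi] := @moving_curve_spec l.+1; first by lia.
    exists ((c' * h`_l) *: ('X_ord_max ^+ (j - l.+1) * F l.+1)); split.
    - by rewrite rpredZ // (dhomogXnM _ hF1.1) // subnK.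
    - rewrite -mul_mpolyC; do 2 apply: in_idealM; apply: mem_in_ideal.
      by apply: family_in_gens; lia.
    by rewrite psiZ rmorphM rmorphXn /= psiX2 expr1n mul1r Fpsi subn1.
  have [[h01 _ e01] [h11 _ e11]] := sylvester_forms_spec.
  pose m := (l - (k - 1))%N.
  have hhl : hom (i.+1 + 2 * m) h`_l.
    apply: (ghom_quotient nz_w hw).
    by have := hwh l; congr (ghom gr _ _); rewrite /m; lia.
  have [B0 [B1 [hB0 hB1 eB]]] := power_comb_lift (l_comb hhl).
  exists (- (c' *: ('X_ord_max ^+ (j - l.+1) * (B0 * F01 + B1 * F11)))); split.
  - have hB : B0 * F01 + B1 * F11 \is (m + k).-homog.
      by apply: rpredD; [apply: dhomogM hB0 h01.1 | apply: dhomogM hB1 h11.1].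
    rewrite rpredN rpredZ // (dhomogXnM _ hB) // /m.
    by clear -hk lt_lj le_kl; lia.
  - rewrite -mulN1r -mul_mpolyC; do 3 apply: in_idealM.
    by apply: in_idealD; apply: in_idealM; apply: mem_in_ideal; rewrite !inE eqxx ?orbT.
  rewrite rmorphN /= psiZ rmorphM rmorphXn /= psiX2 expr1n mul1r rmorphD !rmorphM /= e01 e11.
  transitivity (c' *: ((l0 *: psi B0 + l1 *: psi B1) * ('X^(k - 1) * psi (F 1%N)))).
    by rewrite -!mul_polyC; ring.
  rewrite eB (_ : (l : nat) = m + (k - 1))%N ?exprD; last by rewrite /m; lia.
  by rewrite -!mul_polyC polyCM; ring.
have [t ht] := fin_all_exists term.
pose S := \sum_l t l.
have hS : S \is j.-homog by apply: rpred_sum => l _; case: (ht l).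
have psiS : psi S = psi G.
  rewrite eh rmorph_sum /=; transitivity (\sum_(l < j) (h`_l *: 'X^l) * (c' *: psi (F 1%N))).
    by apply: eq_bigr => l _; case: (ht l) => _ _ ->; rewrite -!mul_polyC polyCM; ring.
  rewrite -mulr_suml mulrC eQ scalerA mulrC (mulrC c') cc' scale1r mulrC; congr (_ * _).
  apply/polyP => x; rewrite coef_sum.
  have [lt_xj|le_jx] := ltnP x j.
    rewrite (bigD1 (Ordinal lt_xj)) //= coefZ coefXn eqxx mulr1 big1 ?addr0 // => y ne_y.
    rewrite coefZ coefXn; case: eqP => [e|_]; last by rewrite mulr0.
    by case/eqP: ne_y; apply: val_inj.
  rewrite big1 => [|y _]; first by rewrite nth_default // (leq_trans sh).
  rewrite coefZ coefXn; case: eqP => [e|_]; last by rewrite mulr0.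
  by have := ltn_ord y; rewrite -e ltnNge le_jx.
have hGS : G - S \is j.-homog by rewrite rpredB // hG.1.
have dvdP : rdvd P (G - S).
  by apply: (psi_kernel nz_p1 p1_cancel hGS); rewrite rmorphB /= psiS subrr.
rewrite -(subrK S G); apply: in_idealD.
  by apply: rdvd_in_ideal dvdP; rewrite !inE eqxx ?orbT.
by apply: in_ideal_sum => l _; case: (ht l).
Qed.

Hypotheses (hE : bihom gr 0 (2 * k) E) (E0 : E.@[u] = 0) (nz_E : E != 0).
Hypotheses (E_gen : forall j G, bihom gr 0 j G -> G.@[u] = 0 -> rdvd E G).
Hypotheses (hu : forall i, hom (2 * k) (u i)).

Lemma gens_in_kernel g : g \in gens -> exists i j, bihom gr i j g /\ g.@[u] = 0.
Proof.
have [[h01 e01 _] [h11 e11 _]] := sylvester_forms_spec.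
rewrite mem_cat !inE => /orP[/or4P[] /eqP->|/mapP[j]].
- by exists 0%N, (2 * k)%N.
- by exists 1%N, k.
- by exists 1%N, k.
- by exists 2%N, 1%N; split; [exact: pencil_bihom | exact: pencil_meval].
rewrite mem_iota => hj ->; have [|hFj Fj0 _] := @moving_curve_spec j; first by lia.
by exists (2 * (k - j))%N, j.
Qed.

(** The kernel is bihomogeneous, so its elements can be treated one component at a time: those
    of T-degree 0 by the hypothesis on [E], the others by [positive_T_degree]. *)
Theorem gens_generate : generates (fun G => rees u G = 0) gens.
Proof.
move=> G; split=> [G0|[c ->]].
  have [N [M ->]] := bicomp_sum gr G.
  apply: in_ideal_sum => j _; apply: in_ideal_sum => -[[|i] lt_i] _ /=.
    apply: (rdvd_in_ideal (f := E)); first by rewrite inE eqxx.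
    apply: (E_gen (bicomp_bihom gr 0 j G)); exact: rees_kernel_bicomp hu _ _ _ G0.
  apply: positive_T_degree (bicomp_bihom gr i.+1 j G) _; exact: rees_kernel_bicomp hu _ _ _ G0.
rewrite /rees rmorph_sum big1 // => i _ /=; rewrite rmorphM -/(rees u _) /=.
have [a [b [[hg _] g0]]] := gens_in_kernel (mem_nth 0 (ltn_ord i)).
by rewrite [X in _ * X](rees_homog u hg) g0 scale0r mulr0.
Qed.

Hypotheses (l0_ndvd : ~ rdvd l1 l0) (l1_ndvd : ~ rdvd l0 l1).

(** Position 3 + j holds the moving curve [F j]; for T-degrees this is the default value
    of [nth]. *)
Definition gen_Tdeg m := nth (2 * (k - (m - 3)))%N [:: 0; 1; 1; 2]%N m.
Definition gen_Xdeg m := nth (m - 3)%N [:: 2 * k; k; k; 1]%N m.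

(** The bidegrees (0, 2 k), (1, k) and (2 (k - j), j) are pairwise incomparable, and (2, 1)
    lies only below those of the last kind. *)
Lemma gen_degrees_le l m : (l < k + 3)%N -> (m < k + 3)%N ->
  [&& m != l, gen_Tdeg m <= gen_Tdeg l & gen_Xdeg m <= gen_Xdeg l]%N ->
  [\/ (4 <= l)%N /\ m = 3, l = 1 /\ m = 2 | l = 2 /\ m = 1]%N.
Proof.
clear -hk => lt_l lt_m /and3P[/eqP ne le_T le_X].
move: le_T le_X; rewrite /gen_Tdeg /gen_Xdeg.
case: l m lt_l lt_m ne => [|[|[|[|l]]]] [|[|[|[|m]]]] lt_l lt_m ne /=;
  rewrite ?nth_nil ?subSS ?subn0 => le_T le_X;
  try (by constructor 1); try (by constructor 2); try (by constructor 3); lia.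
Qed.

Lemma gens_bihom m : (m < size gens)%N -> bihom gr (gen_Tdeg m) (gen_Xdeg m) gens`_m.
Proof.
have [[h01 _ _] [h11 _ _]] := sylvester_forms_spec; rewrite gens_size => lt_m.
have [lt_m4|le_4m] := ltnP m 4.
  by move: m lt_m4 {lt_m} => [|[|[|[|m]]]] //= _; exact: pencil_bihom.
rewrite -(subnKC le_4m) gens_nth; last by lia.
have [|hF1 _ _] := @moving_curve_spec (m - 4).+1; first by lia.
rewrite /gen_Tdeg /gen_Xdeg !nth_default // (_ : 4 + (m - 4) - 3 = (m - 4).+1)%N //; lia.
Qed.

(** Cancel s^(k-1) psi(Q). *)
Lemma sylvester_dvd a b S T : a != 0 -> psi S = - (a *: ('X^(k - 1) * psi (F 1%N))) ->
  psi T = - (b *: ('X^(k - 1) * psi (F 1%N))) -> rdvd T S -> rdvd b a.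
Proof.
move=> nz_a eS eT [z ez]; have nz_V : 'X^(k - 1) * psi (F 1%N) != 0.
  by rewrite mulf_neq0 // -size_poly_eq0 size_polyXn.
have e : a%:P = b%:P * psi z.
  apply: (mulfI nz_V); apply: oppr_inj.
  transitivity (psi S); first by rewrite eS -mul_polyC; ring.
  by rewrite ez rmorphM /= eT -mul_polyC; ring.
exists (psi z)`_0; have := congr1 (fun p : {poly R} => p`_0) e.
by rewrite coefC coefCM.
Qed.

(** In each case [gen_degrees_le] leaves at most one generator on the right-hand side of a
    relation. *)
Theorem gens_irredundant : irredundant gens.
Proof.
move=> l lt_l /(bidegree_combination gens_bihom lt_l)[c].
have [[_ _ e01] [_ _ e11]] := sylvester_forms_spec.
have nz_l (a b : R) : ~ rdvd b a -> a != 0.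
  by move=> ba; apply/eqP => a0; apply: ba; rewrite a0; apply: rdvd0.
have lt_ord (m : 'I_(size gens)) : (m < k + 3)%N by have := ltn_ord m; rewrite {2}gens_size.
have lt_l3 : (l < k + 3)%N by rewrite -gens_size.
have single q : (forall m, (m < k + 3)%N ->
    [&& m != l, gen_Tdeg m <= gen_Tdeg l & gen_Xdeg m <= gen_Xdeg l]%N -> m = q) ->
    forall x, x = \sum_(m < size gens | [&& (m : nat) != l, gen_Tdeg m <= gen_Tdeg l
      & gen_Xdeg m <= gen_Xdeg l]%N) c m * gens`_m -> rdvd gens`_q x.
  move=> hq x ->; elim/big_rec: _ => [|m y /(hq _ (lt_ord m)) em hy]; first exact: rdvd0.
  by apply: rdvdD hy; rewrite em; apply: rdvdMl; exists 1; rewrite mulr1.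
have none : (forall m, (m < k + 3)%N ->
    ~~ [&& m != l, gen_Tdeg m <= gen_Tdeg l & gen_Xdeg m <= gen_Xdeg l]%N) ->
    forall x, x = \sum_(m < size gens | [&& (m : nat) != l, gen_Tdeg m <= gen_Tdeg l
      & gen_Xdeg m <= gen_Xdeg l]%N) c m * gens`_m -> x = 0.
  by move=> hn x ->; rewrite big_pred0 // => m; apply/negbTE/hn.
have [lt_l4|le_4l] := ltnP l 4; last first.
  move=> e; have [|z] := single 3 _ _ e.
    by move=> m lt_m /(gen_degrees_le lt_l3 lt_m) [[? ?]|[? ?]|[? ?]]; lia.
  rewrite -(subnKC le_4l) gens_nth; last by lia.
  have [|_ _ Fpsi] := @moving_curve_spec (l - 4).+1; first by lia.
  move/(congr1 psi); rewrite rmorphM /= psi_pencil mul0r Fpsi => /eqP.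
  by rewrite mulf_eq0 (negbTE Qpsi) orbF -size_poly_eq0 size_polyXn.
case: l lt_l4 {lt_l} lt_l3 single none => [|[|[|[|l]]]] // _ lt_l3 single none e.
- case/eqP: nz_E; apply: none e => m lt_m; apply/negP.
  by move/(gen_degrees_le lt_l3 lt_m) => [[? ?]|[? ?]|[? ?]]; lia.
- apply: l0_ndvd;  apply: (sylvester_dvd (nz_l _ _ l0_ndvd) e01 e11).
  by apply: (single 2) e => m lt_m /(gen_degrees_le lt_l3 lt_m) [[? ?]|[? ?]|[? ?]]; lia.
- apply: l1_ndvd; apply: (sylvester_dvd (nz_l _ _ l1_ndvd) e11 e01).
  by apply: (single 1) e => m lt_m /(gen_degrees_le lt_l3 lt_m) [[? ?]|[? ?]|[? ?]]; lia.
have : P = 0.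
  by apply: none e => m lt_m; apply/negP; move/(gen_degrees_le lt_l3 lt_m) => [[? ?]|[? ?]|[? ?]]; lia.
move/(congr1 (mcoeff U_(0))); rewrite mcoeffB !mcoeffZ !mcoeffXU mcoeff0 /=.
by rewrite mulr1 mulr0 subr0 => /eqP; rewrite (negbTE nz_p1).
Qed.

End MovingCurves.

Section LinearMovingCurves.
Variable R : idomainType.
Notation RX := {mpoly R[3]}.

Lemma linear_expand (G : RX) : G \is 1.-homog ->
  G = G@_U_(0) *: 'X_0 + G@_U_(1) *: 'X_1 + G@_U_(ord_max) *: 'X_ord_max.
Proof.
move=> hG; apply/mpolyP => m; rewrite !mcoeffD !mcoeffZ !mcoeffX.
have [h1|ne1] := eqVneq (mdeg m) 1%N; last first.
  have ne i : (U_(i) == m)%MM = false.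
    by apply/eqP => e; rewrite -e mdeg1 eqxx in ne1.
  by rewrite !ne (dhomog_nemf_coeff hG ne1) !mulr0 !addr0.
have /mdeg1P[i /eqP ->] : mdeg m == 1%N by rewrite h1.
by rewrite !eq_mnm1; case: (ord3P i) => ->; rewrite /= ?mulr1 ?mulr0 ?addr0 ?add0r.
Qed.

Lemma linear_syzygy (u : 'I_3 -> R) (G : RX) : G \is 1.-homog -> G.@[u] = 0 ->
  G@_U_(0) * u 0 + G@_U_(1) * u 1 + G@_U_(ord_max) * u ord_max = 0.
Proof.
by move=> /linear_expand {1}->; rewrite !mevalD !mevalZ !mevalXU.
Qed.

Lemma linear_pencil (G : RX) : G \is 1.-homog -> G@_U_(ord_max) = 0 ->
  G = pencil (- G@_U_(1)) G@_U_(0).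
Proof.
by move=> hG e2; rewrite [LHS](linear_expand hG) e2 scale0r addr0 /pencil scaleNr opprK.
Qed.

Lemma rees_kernel_meval (u : 'I_3 -> R) j (G : RX) : G \is j.-homog ->
  rees u G = 0 -> G.@[u] = 0.
Proof.
move=> hG; rewrite (rees_homog _ hG) => /(congr1 (fun p : {poly R} => p`_j)).
by rewrite coefZ coefXn eqxx mulr1 coef0.
Qed.

(** Dividing P by a common factor [c] of its coefficients gives another moving line;
    expressing the latter in the basis and comparing coefficients of P inverts [c]. *)
Lemma basis_element_primitive (u : 'I_3 -> R) (P Q : RX) c a0 a1 : c != 0 ->
  (forall G : RX, rees u G = 0 -> G \is 1.-homog ->
     exists! ab : R * R, G = ab.1 *: P + ab.2 *: Q) ->
  rees u P = 0 -> P \is 1.-homog -> P = pencil (c * a0) (c * a1) ->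
  exists b, c * b = 1.
Proof.
move=> nz_c basis kP hP eP.
have eP' : P = c *: pencil a0 a1.
  by rewrite eP /pencil scalerBr !scalerA.
have hG : pencil a0 a1 \is 1.-homog.
  by rewrite rpredB // rpredZ // dhomogX /= mdeg1.
have kG : rees u (pencil a0 a1) = 0.
  apply: (poly_scaleI nz_c); rewrite scaler0 -[RHS]kP eP' /rees mmapZ.
  by rewrite mul_polyC.
have [[a b] [/= eG _]] := basis _ kG hG.
have [ab [_ uniq_P]] := basis _ kP hP.
have e1 : ab = (1, 0) by apply: uniq_P; rewrite /= scale1r scale0r addr0.
have e2 : ab = (c * a, c * b).
  by apply: uniq_P; rewrite /= [LHS]eP' {1}eG scalerDr !scalerA.
by exists a; move: e1; rewrite e2 => -[].
Qed.

Lemma basis_not_multiple (u : 'I_3 -> R) (P Q : RX) c :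
  (forall G : RX, rees u G = 0 -> G \is 1.-homog ->
     exists! ab : R * R, G = ab.1 *: P + ab.2 *: Q) ->
  rees u Q = 0 -> Q \is 1.-homog -> Q <> c *: P.
Proof.
move=> basis kQ hQ eQ; have [ab [_ uniq_Q]] := basis _ kQ hQ.
have e1 : ab = (0, 1) by apply: uniq_Q; rewrite /= scale1r scale0r add0r.
have e2 : ab = (c, 0) by apply: uniq_Q; rewrite /= scale0r addr0.
by move: e1; rewrite e2 => -[_] /eqP; rewrite eq_sym oner_eq0.
Qed.

Lemma map_mpoly_section (A : nzRingType) (iota : {rmorphism A -> R}) (rho : {additive R -> A})
  (G : RX) : (forall m, iota (rho G@_m) = G@_m) -> map_mpoly iota (map_mpoly rho G) = G.
Proof. by move=> hG; apply/mpolyP => m; rewrite !mcoeff_map_mpoly /= hG. Qed.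

End LinearMovingCurves.

Lemma map_mpoly_homog (A B : nzRingType) (rho : {additive A -> B}) n j (G : {mpoly A[n]}) :
  G \is j.-homog -> map_mpoly rho G \is j.-homog.
Proof.
move=> hG; apply/dhomogP => m; rewrite mcoeff_msupp mcoeff_map_mpoly => nz_m.
apply: (dhomogP _ _ _ hG m); rewrite mcoeff_msupp.
by apply: contraNneq nz_m => ->; rewrite raddf0.
Qed.

Section GradedGenerators.
Variables (R : idomainType) (gr : grading R).
Notation hom := (ghom gr).
Notation RX := {mpoly R[3]}.
Variables (k : nat) (u : 'I_3 -> R) (p0 p1 w u2 T0 T1 l0 l1 : R).
Hypotheses (hk : (3 <= k)%N).
Hypotheses (hp0 : hom 2 p0) (hp1 : hom 2 p1) (hw : hom (2 * k - 2) w) (hu2 : hom (2 * k) u2).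
Hypotheses (nz_p1 : p1 != 0) (p1_cancel : forall c, rdvd p1 (p0 * c) -> rdvd p1 c).
Hypotheses (nz_u2 : u2 != 0) (u2_cancel : forall c, rdvd u2 (w * c) -> rdvd u2 c).
Hypotheses (nz_w : w != 0) (eu : u =1 vec3 (p0 * w) (p1 * w) u2).
Hypotheses (hu : forall i, hom (2 * k) (u i)).
Hypotheses (hom0_unit : forall c, hom 0 c -> c != 0 -> exists c', c * c' = 1).
Hypotheses (hT0 : hom 1 T0) (hT1 : hom 1 T1) (nz_T0 : T0 != 0) (nz_T1 : T1 != 0).
Hypotheses (T_free : forall x y z, hom 0 x -> hom 0 y -> hom 0 z ->
  T0 ^+ 2 * x + T1 ^+ 2 * y + T0 * T1 * z = 0 -> [/\ x = 0, y = 0 & z = 0]).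

Variables (P Q : RX) (F : nat -> RX) (F01 F11 A0 A1 As M0 M1 Ms E : RX).
Hypotheses (eP : P = pencil p0 p1) (F1 : F 1%N = Q).
Hypotheses (hQ : bihom gr (2 * k - 2) 1 Q) (kQ : rees u Q = 0).
Hypotheses (QP : forall c, Q <> c *: P).
Hypotheses (hF : forall j, (2 <= j <= k - 1)%N -> exists G0 G1,
  [/\ bihom gr (2 * (k - j + 1) - 2) (j - 1) G0, bihom gr (2 * (k - j + 1) - 2) (j - 1) G1,
      F (j - 1)%N = p0 *: G0 + p1 *: G1 & F j = 'X_0 * G0 + 'X_1 * G1]).

Definition T_constant (G : RX) := forall m, hom 0 G@_m.

Hypotheses (cA0 : T_constant A0) (cA1 : T_constant A1) (cAs : T_constant As).
Hypotheses (cM0 : T_constant M0) (cM1 : T_constant M1) (cMs : T_constant Ms).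
Hypotheses (eA : P = T0 ^+ 2 *: A0 + T1 ^+ 2 *: A1 + (T0 * T1) *: As).
Hypotheses (eM : F (k - 1)%N = T0 ^+ 2 *: M0 + T1 ^+ 2 *: M1 + (T0 * T1) *: Ms).
Hypotheses (l0E : T1 * l0 = A0@_U_(0) * p0 + A0@_U_(1) * p1).
Hypotheses (l1E : T0 * l1 = A1@_U_(0) * p0 + A1@_U_(1) * p1).
Hypotheses (l_comb : forall m i f, hom (i.+1 + 2 * m) f -> power_comb p0 p1 l0 l1 m f).
Hypotheses (l0_ndvd : ~ rdvd l1 l0) (l1_ndvd : ~ rdvd l0 l1).
Hypotheses (eF01 : M0 * P - A0 * F (k - 1)%N = T1 *: F01).
Hypotheses (eF11 : M1 * P - A1 * F (k - 1)%N = T0 *: F11).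
Hypotheses (cE : bihom gr 0 (2 * k) E) (E0 : E.@[u] = 0) (nz_E : E != 0).
Hypotheses (E_gen : forall j G, bihom gr 0 j G -> G.@[u] = 0 -> rdvd E G).

(** The monomials T_0^2, T_1^2, T_0 T_1 are independent, so each coefficient inherits the
    degree in X. *)
Lemma T_quadratic_coefs j (G a b c : RX) : T_constant a -> T_constant b -> T_constant c ->
  G \is j.-homog -> G = T0 ^+ 2 *: a + T1 ^+ 2 *: b + (T0 * T1) *: c ->
  bihom gr 0 j a /\ bihom gr 0 j b.
Proof.
move=> ha hb hc hG eG.
have van m : mdeg m != j -> a@_m = 0 /\ b@_m = 0.
  move=> ne_m; have := dhomog_nemf_coeff hG ne_m.
  by rewrite eG !mcoeffD !mcoeffZ => /(T_free (ha m) (hb m) (hc m))[].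
by split; split=> //; apply/dhomogP => m; rewrite mcoeff_msupp => nz_m;
   apply/eqP; apply: contraNT nz_m => /van[a0 b0]; rewrite ?a0 ?b0.
Qed.

Lemma psi_linear (G : RX) l T : G \is 1.-homog -> G@_U_(ord_max) = 0 ->
  T * l = G@_U_(0) * p0 + G@_U_(1) * p1 -> psi p0 p1 G = (T * l) *: 'X.
Proof.
move=> /linear_expand hG G2 ->; rewrite {1}hG G2 scale0r addr0 rmorphD /= !psiZ psiX0 psiX1.
by rewrite scalerDl !scalerA.
Qed.

Theorem graded_generators :
  size ([:: E; F01; F11; P] ++ [seq F j | j <- iota 1 (k - 1)]) = (k + 3)%N /\
  minimal_generators (fun G => rees u G = 0)
    ([:: E; F01; F11; P] ++ [seq F j | j <- iota 1 (k - 1)]).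
Proof.
have Q0 : Q.@[u] = 0 := rees_kernel_meval hQ.1 kQ.
have hP : P \is 1.-homog by rewrite eP; exact: (pencil_bihom hp0 hp1).1.
have nz_P : P != 0.
  apply/eqP => /(congr1 (mcoeff U_(0))); rewrite eP mcoeffB !mcoeffZ !mcoeffXU mcoeff0 /=.
  by rewrite mulr1 mulr0 subr0 => /eqP; rewrite (negbTE nz_p1).
have P2 : P@_U_(ord_max) = 0.
  by rewrite eP mcoeffB !mcoeffZ !mcoeffXU /= !mulr0 subr0.
have Qpsi : psi p0 p1 (F 1%N) != 0.
  rewrite F1; apply/eqP => /(psi_kernel nz_p1 p1_cancel hQ.1)[W]; rewrite -eP => eQ.
  have hW : W \is 0.-homog by apply: (homog_quotient nz_P hP); rewrite addn0 -eQ hQ.1.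
  by apply: (QP (c := W@_0%MM)); rewrite eQ {1}(homog0C hW) mulrC mul_mpolyC.
have hQ1 : bihom gr (2 * k - 2) 1 (F 1%N) by rewrite F1.
have Q01 : (F 1%N).@[u] = 0 by rewrite F1.
have [hA0 hA1] := T_quadratic_coefs cA0 cA1 cAs hP eA.
have [hL _ _] := last_moving_conic_spec hk eu hQ1 Q01 hF.
have [hM0 hM1] := T_quadratic_coefs cM0 cM1 cMs hL.1 eM.
have A2 : A0@_U_(ord_max) = 0 /\ A1@_U_(ord_max) = 0.
  by have := P2; rewrite eA !mcoeffD !mcoeffZ => /(T_free (cA0 _) (cA1 _) (cAs _))[].
have A0psi := psi_linear hA0.1 A2.1 l0E; have A1psi := psi_linear hA1.1 A2.2 l1E.
have e01 := eF01; have e11 := eF11; rewrite eP in e01 e11; rewrite eP.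
split; first exact: (gens_size p0 p1 hk).
apply: irredundant_minimal.
  exact: (gens_irredundant hk hp0 hp1 eu hQ1 Q01 hF hT0 hT1 nz_T0 nz_T1 hA0 hA1
    A0psi A1psi hM0 hM1 e01 e11).
exact: (gens_generate hk hp0 hp1 eu hQ1 Q01 hF hT0 hT1 nz_T0 nz_T1 hA0 hA1
  A0psi A1psi hM0 hM1 e01 e11).
Qed.

End GradedGenerators.

(** * The linear forms of the two Sylvester forms *)

Section QuadraticPencil.
Variable K : closedFieldType.
Notation KT := {mpoly K[2]}.
Notation T0 := ('X_ord0 : KT).
Notation T1 := ('X_ord_max : KT).
Variables (a0 b0 c0 a1 b1 c1 : K).

Definition quadratic (a b c : K) : KT := T0 ^+ 2 * a%:MP + T1 ^+ 2 * b%:MP + T0 * T1 * c%:MP.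

Notation p0 := (quadratic a0 b0 c0).
Notation p1 := (quadratic a1 b1 c1).

(** Eliminating T_0^2, respectively T_1^2, between p0 and p1 and dividing by T_1,
    respectively T_0: up to sign, the rows of the Bezout matrix of p0 and p1. *)
Definition bezout0 : KT := (a1 * c0 - a0 * c1)%:MP * T0 + (a1 * b0 - a0 * b1)%:MP * T1.
Definition bezout1 : KT := (b1 * a0 - b0 * a1)%:MP * T0 + (b1 * c0 - b0 * c1)%:MP * T1.

Lemma var_homog (i : 'I_2) : ('X_i : KT) \is 1.-homog.
Proof. by rewrite dhomogX /= mdeg1. Qed.

Lemma var_neq0 (i : 'I_2) : ('X_i : KT) != 0.
Proof. by rewrite -msize_poly_eq0 msizeX. Qed.

Lemma quadratic_homog a b c : quadratic a b c \is 2.-homog.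
Proof.
have hC (x : K) (G : KT) : G \is 2.-homog -> G * x%:MP \is 2.-homog.
  by move=> hG; rewrite mulrC mul_mpolyC rpredZ.
rewrite /quadratic; apply: rpredD; first apply: rpredD; apply: hC; rewrite ?expr2;
  by apply: (dhomogM (var_homog _) (var_homog _)).
Qed.

Lemma linear_homog (x y : K) : x%:MP * T0 + y%:MP * T1 \is 1.-homog.
Proof. by rewrite !mul_mpolyC rpredD // rpredZ // var_homog. Qed.

Lemma bezout0E : T1 * bezout0 = a1%:MP * p0 - a0%:MP * p1.
Proof. by rewrite /bezout0 /quadratic !mpolyCB !mpolyCM; ring. Qed.

Lemma bezout1E : T0 * bezout1 = b1%:MP * p0 - b0%:MP * p1.
Proof. by rewrite /bezout1 /quadratic !mpolyCB !mpolyCM; ring. Qed.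

Lemma linear_eq0 (x y : K) : x%:MP * T0 + y%:MP * T1 = 0 -> x = 0 /\ y = 0.
Proof.
move=> e; have co i := congr1 (mcoeff U_(i)) e.
have := co ord0; have := co ord_max.
rewrite !mul_mpolyC !mcoeffD !mcoeffZ !mcoeffXU !mcoeff0 /=.
by rewrite !mulr0 !mulr1 addr0 add0r.
Qed.

Hypothesis coprime_p : no_common_zero p0 p1.

Lemma meval_quadratic a b c t : (quadratic a b c).@[t] =
  t ord0 ^+ 2 * a + t ord_max ^+ 2 * b + t ord0 * t ord_max * c.
Proof. by rewrite /quadratic !mevalD !mevalM !mevalC !mevalXU. Qed.

(** A relation between the two forms is, after multiplication by T_0 T_1, a syzygy of p0 and p1
    with linear entries, which vanish by coprimality; if x or y were not 0, then p0 and p1 would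
    both vanish at (1:0) or at (0:1). *)
Lemma bezout_free x y : x%:MP * bezout0 + y%:MP * bezout1 = 0 -> x = 0 /\ y = 0.
Proof.
move=> e.
have syz : ((x * a1)%:MP * T0 + (y * b1)%:MP * T1) * p0
    + ((- (x * a0))%:MP * T0 + (- (y * b0))%:MP * T1) * p1 = 0.
  have <- : (x%:MP * bezout0 + y%:MP * bezout1) * (T0 * T1) = 0 by rewrite e mul0r.
  transitivity (x%:MP * T0 * (T1 * bezout0) + y%:MP * T1 * (T0 * bezout1)); last by ring.
  by rewrite bezout0E bezout1E !mpolyCN !mpolyCM; ring.
have [] := syzygy_small (quadratic_homog _ _ _) (quadratic_homog _ _ _) coprime_p
  (linear_homog _ _) (linear_homog _ _) syz.
move=> /linear_eq0 [/eqP xa1 /eqP yb1] /linear_eq0 [/eqP xa0 /eqP yb0].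
move: xa1 yb1 xa0 yb0; rewrite !oppr_eq0 !mulf_eq0.
move=> h1 h2 h3 h4; split; apply/eqP/negPn/negP => nz.
  rewrite (negbTE nz) /= in h1 h3.
  case: (@coprime_p (fun i => (i == ord0)%:R)); first by exists ord0; rewrite eqxx oner_neq0.
  by rewrite !meval_quadratic /= (eqP h1) (eqP h3) !mulr0 !expr0n !mul0r !add0r.
rewrite (negbTE nz) /= in h2 h4.
case: (@coprime_p (fun i => (i == ord_max)%:R)); first by exists ord_max; rewrite eqxx oner_neq0.
by rewrite !meval_quadratic /= (eqP h2) (eqP h4) !mulr0 !expr0n !mul0r !add0r.
Qed.

Lemma bezout_span (x y : K) : exists a b : K,
  x%:MP * T0 + y%:MP * T1 = a%:MP * bezout0 + b%:MP * bezout1.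
Proof.
set A := a1 * c0 - a0 * c1; set B := a1 * b0 - a0 * b1.
set C := b1 * a0 - b0 * a1; set D := b1 * c0 - b0 * c1.
have nz_det : A * D - B * C != 0.
  apply/eqP => det0.
  have eDB : D%:MP * bezout0 + (- B)%:MP * bezout1 = 0.
    rewrite /bezout0 /bezout1 -/A -/B -/C -/D.
    transitivity ((A * D - B * C)%:MP * T0 : KT).
      by rewrite (mpolyCB _ (A * D)) mpolyCN !mpolyCM; ring.
    by rewrite det0 mul0r.
  have eCA : C%:MP * bezout0 + (- A)%:MP * bezout1 = 0.
    rewrite /bezout0 /bezout1 -/A -/B -/C -/D.
    transitivity (- (A * D - B * C)%:MP * T1 : KT).
      by rewrite (mpolyCB _ (A * D)) mpolyCN !mpolyCM; ring.
    by rewrite det0 oppr0 mul0r.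
  have [_ /eqP B0] := bezout_free eDB; have [_ /eqP A0] := bezout_free eCA.
  rewrite oppr_eq0 in A0; rewrite oppr_eq0 in B0.
  have [|/eqP] := @bezout_free 1 0; last by rewrite oner_eq0.
  by rewrite /bezout0 -/A -/B (eqP A0) (eqP B0) !mpolyC0 !mul0r !addr0 mulr0.
pose e := (A * D - B * C)^-1.
exists (e * (x * D - y * C)), (e * (y * A - x * B)).
have e1 : e%:MP * (A * D - B * C)%:MP = 1 :> KT by rewrite -mpolyCM mulVf.
rewrite /bezout0 /bezout1 -/A -/B -/C -/D.
transitivity ((e%:MP * (A * D - B * C)%:MP) * (x%:MP * T0 + y%:MP * T1)).
  by rewrite e1 mul1r.
by rewrite !mpolyCM (mpolyCB _ (A * D)) (mpolyCB _ (x * D)) (mpolyCB _ (y * A)) !mpolyCM; ring.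
Qed.

Lemma bezout_ndvd : ~ rdvd bezout1 bezout0 /\ ~ rdvd bezout0 bezout1.
Proof.
have common t : nonzero t -> bezout0.@[t] = 0 -> bezout1.@[t] = 0 -> False.
  move=> [i nz_ti] t0 t1.
  have van x y : x * t ord0 + y * t ord_max = 0.
    have [a [b /(congr1 (meval t))]] := bezout_span x y.
    by rewrite !mevalD !mevalM !mevalC !mevalXU t0 t1 !mulr0 addr0.
  have := van 1 0; have := van 0 1; rewrite !mul1r !mul0r addr0 add0r => e1 e0.
  by case: (ord2P i) nz_ti => ->; rewrite ?e0 ?e1 eqxx.
have dvd_root (x y : KT) : x \is 1.-homog -> rdvd x y ->
    exists2 t, nonzero t & x.@[t] = 0 /\ y.@[t] = 0.
  move=> hx [z ->]; have [t nz_t x0] := form_root hx.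
  by exists t; rewrite // mevalM x0 mul0r.
split=> /dvd_root[|t nz_t [e1 e2]]; try exact: linear_homog; exact: common nz_t _ _.
Qed.

(** Each step uses [forms_generated] to extract one factor p0 or p1, until a form of positive
    degree remains, which lies in (T_0, T_1) = (l0, l1). *)
Lemma forms_power_comb m i f : f \is (i.+1 + 2 * m).-homog ->
  power_comb p0 p1 bezout0 bezout1 m f.
Proof.
elim: m f => [|m IH] f hf /=.
  rewrite muln0 addn0 in hf; have [x [y [_ _ ->]]] := form_split_var hf.
  have [a [b e0]] := bezout_span 1 0; have [a' [b' e1]] := bezout_span 0 1.
  rewrite mpolyC1 mpolyC0 mul1r mul0r addr0 in e0.
  rewrite mpolyC1 mpolyC0 mul1r mul0r add0r in e1.
  exists (x * a%:MP + y * a'%:MP), (x * b%:MP + y * b'%:MP).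
  by rewrite {1}e0 {1}e1; ring.
have [|x [y [hx hy ->]]] := @forms_generated K 1 p0 p1 (i + 2 * m) f
    (quadratic_homog _ _ _) (quadratic_homog _ _ _) coprime_p.
  by rewrite (_ : 1 + (i + 2 * m) + 2 = i.+1 + 2 * m.+1)%N //; lia.
by exists x, y; split=> //; apply: IH.
Qed.

End QuadraticPencil.

(** * The theorem *)

Section Coefficients.
Variables (R : idomainType) (A : comNzRingType) (iota : {rmorphism A -> R}).
Notation RX := {mpoly R[3]}.

Lemma meval_map_mpoly (u : 'I_3 -> R) (G : {mpoly A[3]}) :
  (map_mpoly iota G).@[u] = mmap iota u G.
Proof.
rewrite /map_mpoly (mmap_comp _ (meval u)) /mmap; apply: eq_bigr => m _ /=.
by rewrite mevalC; congr (_ * _); apply: mmap1_eq => i /=; rewrite mevalXU.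
Qed.

Lemma mcoeff_comb3 (x y z : R) (a b c : {mpoly A[3]}) m :
  (x *: map_mpoly iota a + y *: map_mpoly iota b + z *: map_mpoly iota c)@_m
  = x * iota a@_m + y * iota b@_m + z * iota c@_m.
Proof. by rewrite !mcoeffD !mcoeffZ !mcoeff_map_mpoly. Qed.

Lemma rdvd_map_mpoly (E G : {mpoly A[3]}) :
  rdvd E G -> rdvd (map_mpoly iota E) (map_mpoly iota G).
Proof. by case=> z ->; exists (map_mpoly iota z); rewrite rmorphM. Qed.

End Coefficients.

Section Forms.
Variable K : closedFieldType.
Notation KT := {mpoly K[2]}.

(** Proportional to coprime forms means multiple of them. *)
Lemma coprime_forms_split (u0 u1 p0 p1 : KT) m d : p0 \is m.-homog -> p1 \is m.-homog ->
  p1 != 0 -> no_common_zero p1 p0 -> u1 \is (m + d).-homog -> p1 * u0 = p0 * u1 ->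
  exists w, [/\ w \is d.-homog, u0 = p0 * w & u1 = p1 * w].
Proof.
move=> h0 h1 nz_p1 p10 hu1 e; have [|w ew] := coprime_cancel nz_p1 h1 p10 (W := u1).
  by exists u0; rewrite e.
exists w; split=> //; first by apply: (homog_quotient nz_p1 h1); rewrite -ew.
by apply: (mulfI nz_p1); rewrite e ew mulrCA.
Qed.

Lemma quadratic_free (a b c : K) : quadratic a b c = 0 -> [/\ a = 0, b = 0 & c = 0].
Proof.
move=> e; pose pt (x y : K) (i : 'I_2) := if i == ord0 then x else y.
have val x y : x ^+ 2 * a + y ^+ 2 * b + x * y * c = 0.
  by have := meval_quadratic a b c (pt x y); rewrite e meval0 /pt /= => <-.
have a0 : a = 0 by have := val 1 0; rewrite expr1n expr0n /= !mul0r !addr0 mulr0 mul0r addr0 mul1r.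
have b0 : b = 0 by have := val 0 1; rewrite expr1n expr0n /= !mul0r add0r addr0 mul1r.
by split=> //; have := val 1 1; rewrite a0 b0 !mulr0 !add0r !mul1r.
Qed.

Lemma degree0_unit (x : KT) : x \is 0.-homog -> x != 0 -> exists y, x * y = 1.
Proof.
move=> hx nz_x; exists ((x@_0%MM)^-1)%:MP.
have nz_c : x@_0%MM != 0 by apply: contraNneq nz_x => c0; rewrite (homog0C hx) c0.
by rewrite {1}(homog0C hx) -mpolyCM divff.
Qed.

End Forms.

Theorem theorem3p7 (K : closedFieldType) (d k mu : nat)
  (u : 'I_3 -> {mpoly K[2]})
  (E : {mpoly K[3]})
  (P Q : {mpoly {mpoly K[2]}[3]})
  (F : nat -> {mpoly {mpoly K[2]}[3]})
  (F0 F1 Fs M0 M1 Ms : {mpoly K[3]})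
  (F01k F11k : {mpoly {mpoly K[2]}[3]})
  (hk : (3 <= k)%N) (hd : d = (2 * k)%N) (hmu : mu = 2%N)
  (hu : parametrization d u)
  (hPQ : mu_basis u d mu P Q)
  (hproper : proper_param u)
  (hE : curve_equation u d E)
  (hsing : very_singular u E mu (@pt001 K))
  (hF : F_family k P Q F)
  (hP2 : T_quadratic P F0 F1 Fs)
  (hM2 : T_quadratic (F (k - 1)%N) M0 M1 Ms)
  (hF01k : liftX M0 * P - liftX F0 * F (k - 1)%N = ('X_1 : {mpoly K[2]}) *: F01k)
  (hF11k : liftX M1 * P - liftX F1 * F (k - 1)%N = ('X_0 : {mpoly K[2]}) *: F11k) :
  size (generators k E F01k F11k P F) = (k + 3)%N /\
  minimal_generators (rees_ker u) (generators k E F01k F11k P F).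
Proof.
subst d mu.
have [_ [kP [hP cP]] [kQ hQ] basis] := hPQ.
have d_gt0 : (0 < 2 * k)%N by lia.
have d_ge6 : (6 <= 2 * k)%N by lia.
pose p0 := coef_p0 P; pose p1 := coef_p1 P.
have P0 : P.@[u] = 0 := rees_kernel_meval hP kP.
have syz := linear_syzygy hP P0.
have P2 : P@_U_(ord_max) = 0 :=
  very_singular_syzygy (b := fun i => P@_U_(i)) d_ge6 hu hproper hE hsing (fun i => cP _) syz.
have eP : P = pencil p0 p1 := linear_pencil hP P2.
have hp1 : p1 \is 2.-homog := cP _.
have hp0 : p0 \is 2.-homog by rewrite rpredN; exact: cP.
have coprime_p : no_common_zero p0 p1.
  move=> t nz_t [p0t p1t].
  have [a0 _ e0] := form_at_point nz_t hp0 p0t.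
  have [a1 _ e1] := form_at_point nz_t hp1 p1t.
  have ePl : P = pencil (line t * a0) (line t * a1) by rewrite -e0 -e1.
  have [b /(congr1 (ev_line t))] :=
    basis_element_primitive (line_neq0 nz_t) basis kP hP ePl.
  by rewrite rmorphM rmorph1 /= ev_line_line mul0r => /eqP; rewrite eq_sym oner_eq0.
have p1p0 := no_common_zeroC coprime_p.
have nz_p1 : p1 != 0 := no_common_zero_neq0 hp0 p1p0.
have hu_homog := param_homog hu.
have hu1 : u 1 \is (2 + (2 * k - 2)).-homog by rewrite subnKC; [exact: hu_homog | lia].
have [|w [hw eu0 eu1]] := coprime_forms_split (u0 := u 0) hp0 hp1 nz_p1 p1p0 hu1.
  apply/eqP; rewrite -subr_eq0 /p0 /p1 /coef_p0 /coef_p1 mulNr opprK.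
  by move/eqP: syz; rewrite P2 mul0r addr0.
have coprime_w : no_common_zero w (u ord_max).
  move=> t nz_t [wt u2t]; have [i] := param_no_common_zero d_gt0 hu nz_t.
  by case: (ord3P i) => ->; rewrite ?eu0 ?eu1 ?mevalM ?wt ?mulr0 ?u2t eqxx.
have hu2 : u ord_max \is (2 * k).-1.+1.-homog by rewrite prednK //; exact: hu_homog.
have hw' : w \is (2 * k - 3).+1.-homog by rewrite (_ : (2 * k - 3).+1 = 2 * k - 2)%N //; lia.
have nz_w : w != 0 := no_common_zero_neq0 hu2 coprime_w.
have nz_u2 : u ord_max != 0 := no_common_zero_neq0 hw' (no_common_zeroC coprime_w).
have eu : u =1 vec3 (p0 * w) (p1 * w) (u ord_max).
  by move=> i; case: (ord3P i) => ->; rewrite /vec3 /= ?eu0 ?eu1.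
have var1 : (1 : 'I_2) = ord_max by apply: val_inj.
rewrite /T_quadratic var1 in hP2 hM2; rewrite var1 in hF01k.
have coefP m : P@_m = quadratic F0@_m F1@_m Fs@_m by rewrite hP2 mcoeff_comb3.
have eq_p1 : p1 = quadratic F0@_U_(0) F1@_U_(0) Fs@_U_(0) := coefP _.
have eq_p0 : p0 = quadratic (- F0@_U_(1)) (- F1@_U_(1)) (- Fs@_U_(1)).
  by rewrite /p0 /coef_p0 coefP /quadratic !mpolyCN; ring.
have cop := coprime_p; rewrite eq_p0 eq_p1 in cop.
have const_liftX (G : {mpoly K[3]}) : T_constant (total_degree 2 K) (liftX G).
  by move=> m /=; rewrite mcoeff_map_mpoly /= -[_%:MP]mulr1 mul_mpolyC rpredZ // dhomog1.
have [irrE hEd _] := hE.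
have E0 := equation_vanishes d_gt0 hu hE.
have [l0_ndvd l1_ndvd] := bezout_ndvd cop.
(* The coordinates u_0 and u_1 are w times the coprime forms p0 and p1. *)
have inj01 : binary_injective u.
  apply: (coprime_pair_binary_injective nz_w hp0 hp1 coprime_p); rewrite mulrC.
    by rewrite -eu0; congr u; apply: val_inj.
  by rewrite -eu1; congr u; apply: val_inj.
have E_gen j G : bihom (total_degree 2 K) 0 j G -> G.@[u] = 0 -> rdvd (liftX E) G.
  move=> [hG cG]; have <- : liftX (map_mpoly (mcoeff 0) G) = G.
    by apply: map_mpoly_section => m; rewrite /= -(homog0C (cG m)).
  rewrite /liftX meval_map_mpoly => G0; apply: rdvd_map_mpoly.
  apply: (curve_generates_kernel irrE hEd _ inj01 (map_mpoly_homog _ hG)).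
    by rewrite param_eval_muni.
  by rewrite param_eval_muni.
have nz_E : liftX E != 0.
  apply/eqP => e; case: irrE => /eqP nz _ _; apply: nz; apply/mpolyP => m.
  have /(congr1 (mcoeff 0)) := congr1 (mcoeff m) e.
  by rewrite mcoeff_map_mpoly /= mpolyCK !mcoeff0.
have T_free x y z : x \is 0.-homog -> y \is 0.-homog -> z \is 0.-homog ->
    ('X_ord0 : {mpoly K[2]}) ^+ 2 * x + 'X_ord_max ^+ 2 * y + 'X_ord0 * 'X_ord_max * z = 0 ->
    [/\ x = 0, y = 0 & z = 0].
  move=> /homog0C -> /homog0C -> /homog0C -> /quadratic_free[-> -> ->].
  by rewrite !mpolyC0.
apply: (@graded_generators {mpoly K[2]} (total_degree 2 K) k u p0 p1 w (u ord_max)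
  'X_ord0 'X_ord_max _ _ hk hp0 hp1 hw (hu_homog _) nz_p1 _ nz_u2 _ nz_w eu hu_homog
  (@degree0_unit K) (var_homog K _) (var_homog K _) (var_neq0 K _) (var_neq0 K _) T_free
  P Q F F01k F11k (liftX F0) (liftX F1) (liftX Fs) (liftX M0) (liftX M1) (liftX Ms) (liftX E)
  eP hF.1 hQ kQ _ hF.2 (const_liftX _) (const_liftX _) (const_liftX _) (const_liftX _)
  (const_liftX _) (const_liftX _) hP2 hM2 _ _ _ l0_ndvd l1_ndvd hF01k hF11k _ _ nz_E E_gen).
- move=> c; exact: (coprime_cancel nz_p1 hp1 p1p0).
- move=> c; exact: (coprime_cancel nz_u2 (hu_homog _) (no_common_zeroC coprime_w)).
- move=> c; exact: (basis_not_multiple basis kQ hQ.1).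
- by rewrite !mcoeff_map_mpoly /= bezout0E eq_p0 eq_p1 mpolyCN; ring.
- by rewrite !mcoeff_map_mpoly /= bezout1E eq_p0 eq_p1 mpolyCN; ring.
- by rewrite eq_p0 eq_p1 => m i f; apply: forms_power_comb.
- split; last exact: const_liftX.
  exact: map_mpoly_homog.
by rewrite /liftX meval_map_mpoly.
Qed.
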